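(* Let $\Omega=\mathbb T^d_{\boldsymbol L}$ and let $\mathbf F\in\mathbb R^d$ be a constant background field. Consider the system $$(\mathbf F\cdot\nabla)\boldsymbol v=\boldsymbol h,\qquad \nabla\cdot\boldsymbol v=0\qquad\text{on }\Omega.\tag{$*$}$$ (i) For $\boldsymbol h\in L^2_{\mathrm{per},0}(\Omega;\mathbb R^d)$, a solution $\boldsymbol v\in L^2_{\mathrm{per},0}(\Omega;\mathbb R^d)$ to $( * )$, if it exists, is unique if and only if $\mathcal R=\emptyset$, i.e., $\mathbf F$ satisfies the incommensurability condition $\mathbf F\cdot\boldsymbol g(\boldsymbol k)\neq 0$ for all $\boldsymbol k\in\mathbb Z^d\setminus\{\boldsymbol 0\}$. (ii) If $\mathbf F$ satisfies the Diophantine condition with exponent $\tau\ge d-1$, i.e., for some $C>0$, $$|\mathbf F\cdot\boldsymbol g(\boldsymbol k)|\ge\frac{C}{|\boldsymbol k|^\tau}\qquad\text{for all }\boldsymbol k\in\mathbb Z^d\setminus\{\boldsymbol 0\},$$ and $\boldsymbol h\in H^\tau_{\mathrm{per},0}(\Omega;\mathbb R^d)$, then the system $( * )$ admits a unique solution $\boldsymbol v\in L^2_{\mathrm{per},0}(\Omega;\mathbb R^d)$. (iii) Suppose $\boldsymbol h\in L^2_{\mathrm{per},0}(\Omega;\mathbb R^d)$ is divergence-free in the sense of distributions. If $\boldsymbol v\in L^2_{\mathrm{per},0}(\Omega;\mathbb R^d)$ is a solution to $( * )$ that satisfies $\hat{\boldsymbol v}(\boldsymbol k)=\boldsymbol 0$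 for all $\boldsymbol k\in\mathcal R$, then $\boldsymbol v$ is also divergence-free.
   Context: Throughout, $d\in\{2,3\}$. For $\boldsymbol L=(L_1,\dots,L_d)$ with all $L_i>0$, $\mathbb T^d_{\boldsymbol L}$ is the $d$-dimensional torus with side lengths $L_1,\dots,L_d$, i.e. $\prod_{i=1}^d[0,L_i)$ with periodic identification. $L^2_{\mathrm{per},0}(\Omega;\mathbb R^d)$ and $H^s_{\mathrm{per},0}(\Omega;\mathbb R^d)$ denote the spaces of periodic $L^2$, respectively $H^s$ Sobolev, vector fields $\boldsymbol u$ with $\int_\Omega\boldsymbol u\,d\boldsymbol x=\boldsymbol 0$. For $\boldsymbol k\in\mathbb Z^d$ set $\boldsymbol g(\boldsymbol k)=(k_1/L_1,\dots,k_d/L_d)$ and $e_{\boldsymbol k}(\boldsymbol x)=e^{2\pi\mathrm i\,\boldsymbol g(\boldsymbol k)\cdot\boldsymbol x}$; $\hat{\boldsymbol v}(\boldsymbol k)\in\mathbb C^d$ are the Fourier coefficients in $\boldsymbol v=\sum_{\boldsymbol k\in\mathbb Z^d}\hat{\boldsymbol v}(\boldsymbol k)e_{\boldsymbol k}$. The resonant set is $$\mathcal R=\{\boldsymbol k\in\mathbb Z^d\setminus\{\boldsymbol 0\}:\mathbf F\cdot\boldsymbol g(\boldsymbol k)=0\}.$$ The operator $(\mathbf F\cdot\nabla)=\sum_{i=1}^d F_i\partial_{x_i}$ acts componentwise; equations are understood in the sense of distributions on the torus.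
   Formalization: In (ii), existence for the full system ( * ) is stated for divergence-free h, a necessary condition (it fails for h = grad cos(2πx_1/L_1)); for general h, existence and uniqueness are given for (F·∇)v = h alone. *)

(* Defs.v *)
From HB Require Import structures.
From mathcomp Require Import all_boot all_order all_algebra.
From mathcomp Require Import complex.
From mathcomp Require Import all_classical all_reals all_analysis.

Set Implicit Arguments.
Unset Strict Implicit.
Unset Printing Implicit Defensive.

Import Order.TTheory GRing.Theory Num.Theory.
Import numFieldNormedType.Exports.

Local Open Scope classical_set_scope.
Local Open Scope ring_scope.

(* measurableTypeR R carries the sigma-algebra on which lebesgue_measure lives. *)
Notation points R d := (d.-tuple (measurableTypeR R)).

Section cons_measure.
Context {R : realType} (n : nat).
Variable m : {sigma_finite_measure set (points R n) -> \bar R}.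

Definition pair_cons (p : measurableTypeR R * points R n) : points R n.+1 :=
  [tuple of p.1 :: p.2].

Definition uncons (x : points R n.+1) : measurableTypeR R * points R n :=
  (tnth x ord0, [tuple of behead x]).

Lemma pair_consK : cancel pair_cons uncons.
Proof. by case=> t x; congr pair => //; exact: val_inj. Qed.

Lemma measurable_pair_cons : measurable_fun setT pair_cons.
Proof. exact: measurable_cons. Qed.

Lemma measurable_uncons : measurable_fun setT uncons.
Proof.
apply/measurable_fun_pairP; split; first exact: measurable_tnth.
exact: measurable_behead.
Qed.

Definition cons_measure : set (points R n.+1) -> \bar R :=
  pushforward (@lebesgue_measure R \x m)%E pair_cons.

Let cons_measure0 : cons_measure set0 = 0%E.
Proof. by apply: measure0; exact: measurable_pair_cons. Qed.

Let cons_measure_ge0 A : (0 <= cons_measure A)%E.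
Proof. by apply: measure_ge0; exact: measurable_pair_cons. Qed.

Let cons_measure_sigma_additive : semi_sigma_additive cons_measure.
Proof.
by apply: measure_semi_sigma_additive; exact: measurable_pair_cons.
Qed.

HB.instance Definition _ := isMeasure.Build _ _ _ cons_measure
  cons_measure0 cons_measure_ge0 cons_measure_sigma_additive.

Let product_sigma_finite : sigma_finite setT (@lebesgue_measure R \x m)%E.
Proof.
have /sigma_finiteP[F [TF ndF Foo]] := sigma_finiteT (@lebesgue_measure R).
have /sigma_finiteP[G [TG ndG Goo]] := sigma_finiteT m.
exists (fun i => F i `*` G i) => [|i].
  rewrite -setXTT TF TG; apply/seteqP; split=> [[x y] [[i _ Fx] [j _ Gy]]|].
    exists (maxn i j) => //; split => /=.
      by apply: (subsetPset _ _ (ndF _ _ (leq_maxl i j))); exact: Fx.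
    by apply: (subsetPset _ _ (ndG _ _ (leq_maxr i j))); exact: Gy.
  by move=> [x y] [i _ [Fx Gy]]; split; exists i.
have [mF Fi] := Foo i; have [mG Gi] := Goo i.
split; first exact: measurableX.
by rewrite product_measure1E// lte_mul_pinfty// ge0_fin_numE.
Qed.

Let cons_measure_sigma_finite : sigma_finite setT cons_measure.
Proof.
have [A UA mA] := product_sigma_finite.
exists (fun i => uncons @^-1` A i) => [|i].
  by rewrite -preimage_bigcup -UA preimage_setT.
split.
  by rewrite -[X in measurable X]setTI; exact: measurable_uncons (mA i).1.
rewrite /cons_measure /pushforward -comp_preimage.
rewrite (_ : uncons \o pair_cons = id); last exact/funext/pair_consK.
exact: (mA i).2.
Qed.

HB.instance Definition _ := Measure_isSigmaFinite.Build _ _ _ cons_measure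
  cons_measure_sigma_finite.
End cons_measure.

Fixpoint tuple_lebesgue (R : realType) n :
    {sigma_finite_measure set (points R n) -> \bar R} :=
  match n with
  | 0 => dirac [tuple]
  | n'.+1 => cons_measure (tuple_lebesgue R n')
  end.

Section torus.
Context {R : realType} {d : nat}.
Implicit Types (L F : 'rV[R]_d) (x : points R d) (k : 'rV[int]_d).

Definition cell L : set (points R d) :=
  [set x | forall i, 0 <= tnth x i < L ord0 i].

Lemma measurable_cell L : measurable (cell L).
Proof.
rewrite (_ : cell L =
  \big[setI/setT]_(i < d) ((@tnth d _)^~ i @^-1` `[0, L ord0 i[)).
  apply: bigsetI_measurable => i _.
  rewrite -[X in measurable X]setTI; apply: measurable_tnth => //.
apply/seteqP; split => x /=.
  by move=> Lx; rewrite -bigcap_seq => i _ /=; rewrite in_itv/=; exact: Lx.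
rewrite -bigcap_seq => Lx i.
by have := Lx i; rewrite /= mem_index_enum in_itv; exact.
Qed.

(* A function on the torus is represented by a function on R^d of which only
   the values on the fundamental cell matter, and two such functions are
   identified when they agree (torus L)-almost everywhere. The periodic
   identification enters through the test functions and the Fourier modes. *)
Definition torus L : {measure set (points R d) -> \bar R} :=
  mrestr (tuple_lebesgue R d) (measurable_cell L).

Definition vec x : 'rV[R]_d := \row_i tnth x i.

Definition dot (u w : 'rV[R]_d) : R := \sum_(i < d) u ord0 i * w ord0 i.

Definition enorm (u : 'rV[R]_d) : R := Num.sqrt (dot u u).

Definition to_real k : 'rV[R]_d := map_mx intr k.

Definition freq L k : 'rV[R]_d := \row_i ((k ord0 i)%:~R / L ord0 i).

Definition resonant L F : set 'rV[int]_d :=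
  [set k | k != 0 /\ dot F (freq L k) = 0].

Definition expmode L k x : R[i] :=
  let t := 2 * pi * dot (freq L k) (vec x) in (cos t +i* sin t)%C.

Definition cintegral L (f : points R d -> R[i]) : R[i] :=
  ((\int[torus L]_x complex.Re (f x)) +i* (\int[torus L]_x complex.Im (f x)))%C.

(* The component with index i of a vector field v is v i. *)
Definition vfield := 'I_d -> points R d -> R.

Definition fourier L (v : vfield) k : 'rV[R[i]]_d :=
  \row_i (((\prod_j L ord0 j)^-1)%:C%C *
          cintegral L (fun x => (v i x)%:C%C * (expmode L k x)^*%C)).

Definition L2per0 L (v : vfield) : Prop :=
  forall i, v i \in Lfun (torus L) 2%:E /\ \int[torus L]_x v i x = 0.

(* When all the L_i are positive, the weight (1 + |2 pi g(k)|^2)^s would give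
   the same space with an equivalent norm. *)
Definition Hper0 L (s : R) (v : vfield) : Prop :=
  L2per0 L v /\
  (\esum_(k in [set: 'rV[int]_d])
     ((1 + enorm (to_real k) ^+ 2) `^ s *
      \sum_(i < d) ComplexField.Normc.normc (fourier L v k ord0 i) ^+ 2)%:E
   < +oo)%E.

Definition ae_eq_field L (v w : vfield) : Prop :=
  forall i, ae_eq (torus L) setT (v i) (w i).

Definition partial (i : 'I_d) (phi : 'rV[R]_d -> R) : 'rV[R]_d -> R :=
  'D_(delta_mx ord0 i) phi.

(* foldr partial phi s is the iterated partial derivative along the list s. *)
Definition smooth (phi : 'rV[R]_d -> R) : Prop :=
  forall s : seq 'I_d, let f := foldr partial phi s in
  continuous f /\ forall i (y : 'rV[R]_d), derivable f y (delta_mx ord0 i).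

Definition test L (phi : 'rV[R]_d -> R) : Prop :=
  smooth phi /\
  forall i y, phi (y + L ord0 i *: delta_mx ord0 i) = phi y.

(* Real-valued test functions suffice, as the fields are real-valued. *)
Definition transport_weak L F (v h : vfield) : Prop :=
  forall i phi, test L phi ->
  - (\int[torus L]_x
       (v i x * \sum_(j < d) F ord0 j * partial j phi (vec x))) =
  \int[torus L]_x (h i x * phi (vec x)).

Definition div_free_weak L (v : vfield) : Prop :=
  forall phi, test L phi ->
  \int[torus L]_x (\sum_(i < d) v i x * partial i phi (vec x)) = 0.

Definition system L F (v h : vfield) : Prop :=
  transport_weak L F v h /\ div_free_weak L v.

Definition diophantine L F (tau : R) : Prop :=
  exists2 C : R, 0 < C & forall k, k != 0 ->
    C / enorm (to_real k) `^ tau <= `|dot F (freq L k)|.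

End torus.
Arguments vfield : clear implicits.

(* Main.v *)
(* Write theta_k(x) = 2 pi g(k).x, omega_k = 2 pi F.g(k) (detuning), and let A_k, B_k be the
   cosine and sine coefficients of a component of v, A'_k, B'_k those of h. Testing
   with trigonometric modes turns the transport equation into A'_k = omega_k B_k,
   B'_k = - omega_k A_k, and the divergence equation into the orthogonality of the
   coefficient vectors to g(k). Conversely these relations imply the weak equations:
   every L^2 function f is the weak limit of finite Fourier sums S_n (Riesz-Fischer
   along a fast exhaustion of Z^d, the limit being identified with f by completeness),
   and for S_n one integrates by parts. Hence v is unique iff no omega_k vanishes for
   k != 0, a resonant k giving the solution cos(theta_k) c with c orthogonal to g(k);
   dividing by omega_k, under the Diophantine bound, solves the equation.

   Completeness: if f is orthogonal to all trigonometric polynomials, then it is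
   orthogonal to the indicator of [u > 0] for each such polynomial u, because this
   indicator is a bounded pointwise limit of polynomials in u. These sets generate the
   sigma-algebra, so f = 0 almost everywhere by Dynkin's theorem. *)
Require Import Defs.
From mathcomp Require Import all_boot all_order all_algebra.
From mathcomp Require Import complex ring lra.
From mathcomp Require Import all_classical all_reals all_analysis.
From mathcomp Require Import measurable_realfun.

Set Implicit Arguments.
Unset Strict Implicit.
Unset Printing Implicit Defensive.

Import Order.TTheory GRing.Theory Num.Theory.
Import numFieldNormedType.Exports.

Local Open Scope classical_set_scope.
Local Open Scope ring_scope.

(** * Square-integrable functions on a finite measure space *)

Section square_integrable.
Context {dd : measure_display} {T : measurableType dd} {R : realType}.
Variable mu : {measure set T -> \bar R}.
Hypothesis muT : (mu setT < +oo)%E.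
Implicit Types f g : T -> R.

(** [sqint_Lfun] identifies this with membership in [Lfun mu 2%:E]; squares are easier to handle
    algebraically than powers of absolute values. *)
Definition sqint f := measurable_fun setT f /\
  mu.-integrable setT (EFin \o (fun x => f x ^+ 2)).

(** An almost everywhere bound is the right notion for [torus L]: continuous functions are bounded
    on the cell, and the complement of the cell is null. *)
Definition ae_bounded f := exists M : R, {ae mu, forall x, `|f x| <= M}.

Notation Rint f := (mu.-integrable setT (EFin \o f)).

Lemma RintegrableD f g : Rint f -> Rint g -> Rint (fun x => f x + g x).
Proof. by move=> intf intg; exact: (integrableD measurableT intf intg). Qed.

Lemma RintegrableZ c f : Rint f -> Rint (fun x => c * f x).
Proof. exact: integrableZl. Qed.

Lemma ae_bounded_integrable f : measurable_fun setT f -> ae_bounded f ->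
  Rint f.
Proof.
move=> mf [M fM]; apply/integrableP; split; first exact/measurable_EFinP.
apply: le_lt_trans.
  apply: (integral_le_bound (`|M|)%:E) => //.
  - exact/measurable_EFinP.
  - by apply: filterS fM => x fx _; rewrite lee_fin (le_trans fx)// ler_norm.
by rewrite lte_mul_pinfty.
Qed.

(** The dominating function is f^2 + g^2, since 2|fg| <= f^2 + g^2. *)
Lemma sqint_mul f g : sqint f -> sqint g ->
  Rint (fun x => f x * g x).
Proof.
move=> [mf f2] [mg g2].
apply: (le_integrable _ _ _ (integrableD measurableT f2 g2)) => //.
  by apply/measurable_EFinP; exact: measurable_funM.
move=> x _ /=; rewrite lee_fin [leRHS]ger0_norm ?addr_ge0 ?sqr_ge0//.
rewrite normrM -(real_normK (num_real (f x))) -(real_normK (num_real (g x))).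
have := sqr_ge0 (`|f x| - `|g x|).
have := normr_ge0 (f x); have := normr_ge0 (g x); nra.
Qed.

Lemma sqintD f g : sqint f -> sqint g -> sqint (fun x => f x + g x).
Proof.
move=> sf sg; split; first by apply: measurable_funD; [exact: sf.1|exact: sg.1].
under eq_fun do rewrite sqrrD -mulr_natl.
apply: RintegrableD (sg.2); apply: RintegrableD (sf.2) _.
by apply: RintegrableZ; exact: sqint_mul.
Qed.

Lemma sqintZ c f : sqint f -> sqint (fun x => c * f x).
Proof.
move=> [mf f2]; split; first exact: measurable_funM.
by under eq_fun do rewrite exprMn; exact: RintegrableZ.
Qed.

Lemma sqintN f : sqint f -> sqint (fun x => - f x).
Proof. by move=> /(sqintZ (-1)); under eq_fun do rewrite mulN1r. Qed.

Lemma sqintB f g : sqint f -> sqint g -> sqint (fun x => f x - g x).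
Proof. by move=> sf /sqintN sg; exact: sqintD. Qed.

Lemma sqint_bounded f : measurable_fun setT f -> ae_bounded f -> sqint f.
Proof.
move=> mf [M fM]; split => //; apply: ae_bounded_integrable.
  exact: measurable_funX.
exists (M ^+ 2); apply: filterS fM => x fx.
by rewrite normrX ler_sqr ?nnegrE// (le_trans _ fx).
Qed.

Lemma sqint_cst c : sqint (cst c).
Proof. by apply: sqint_bounded => //; exists `|c|; exact: aeW. Qed.

Lemma sqint_sum I (s : seq I) (F : I -> T -> R) :
  (forall i, sqint (F i)) -> sqint (fun x => \sum_(i <- s) F i x).
Proof.
move=> sF; elim: s => [|i s ih].
  by under eq_fun do rewrite big_nil; exact: sqint_cst.
by under eq_fun do rewrite big_cons; exact: sqintD.
Qed.

Lemma sqint_integrable f : sqint f -> Rint f.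
Proof.
move=> sf; have := sqint_mul sf (sqint_cst 1).
by congr (mu.-integrable _ _); apply/funext => x /=; rewrite mulr1.
Qed.

Lemma Rintegrable_sum I (s : seq I) (F : I -> T -> R) :
  (forall i, Rint (F i)) -> Rint (fun x => \sum_(i <- s) F i x).
Proof.
move=> iF; elim: s => [|i s ih].
  by under eq_fun do rewrite big_nil; exact: (sqint_integrable (sqint_cst 0)).
by under eq_fun do rewrite big_cons; exact: RintegrableD.
Qed.

Lemma Rintegral_sum I (s : seq I) (F : I -> T -> R) :
  (forall i, Rint (F i)) ->
  \int[mu]_x (\sum_(i <- s) F i x) = \sum_(i <- s) \int[mu]_x F i x.
Proof.
move=> iF; elim: s => [|i s ih].
  rewrite big_nil; under eq_Rintegral do rewrite big_nil.
  by rewrite Rintegral_cst// mul0r.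
rewrite big_cons -ih; under eq_Rintegral do rewrite big_cons.
rewrite RintegralD//; last exact: Rintegrable_sum.
Qed.

Lemma sqint_Lfun f : f \in Lfun mu 2%:E <-> sqint f.
Proof.
split=> [f2|[mf f2]].
  split; last exact: Lfun2_integrable_sqr.
  by move: f2; rewrite inE => /andP[/[!inE]].
rewrite inE; apply/andP; split; rewrite inE//=.
rewrite /finite_norm unlock /= poweR_lty//.
have /integrableP[_] := f2; apply: le_lt_trans.
rewrite ge0_le_integral//.
- apply/measurable_EFinP.
  apply: (@measurableT_comp _ _ _ _ _ _ (fun x : R => x `^ 2)) => //.
  exact: measurableT_comp.
- apply: measurableT_comp => //; apply/measurable_EFinP.
  exact: measurable_funX.
- by move=> x _ /=; rewrite lee_fin normrX powR_mulrn.
Qed.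

Lemma Rdominated_convergence (f_ : nat -> T -> R) f (G : T -> \bar R) :
  (forall n, measurable_fun setT (f_ n)) -> measurable_fun setT f ->
  {ae mu, forall x, f_ n x @[n --> \oo] --> f x} ->
  mu.-integrable setT G ->
  {ae mu, forall x n, (`|f_ n x|%:E <= G x)%E} ->
  \int[mu]_x f_ n x @[n --> \oo] --> \int[mu]_x f x.
Proof.
move=> mf_ mf f_f ig f_g.
have [//|||||] := @dominated_convergence _ _ _ mu setT measurableT
  (fun n x => (f_ n x)%:E) (fun x => (f x)%:E) G.
- by move=> n; exact/measurable_EFinP.
- exact/measurable_EFinP.
- apply: filterS f_f => x fx _; apply: cvg_EFin fx; exact: nearW.
- by [].
- by apply: filterS f_g => x fx n _; exact: fx.
move=> int_f _ cf; apply: fine_cvg.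
by rewrite fineK//; exact: integrable_fin_num int_f.
Qed.

End square_integrable.

(** * Limits of rapidly Cauchy sequences in L^2 *)

Section square_integrable_limit.
Context {dd : measure_display} {T : measurableType dd} {R : realType}.
Variable mu : {measure set T -> \bar R}.
Hypothesis muT : (mu setT < +oo)%E.
Variables (u : nat -> T -> R) (K : R).
Hypothesis u2 : forall n, sqint mu (u n).
Hypothesis u_cauchy : forall n, \int[mu]_x (u n.+1 x - u n x) ^+ 2 <= 4^-1 ^+ n.
Hypothesis u_bound : forall n, \int[mu]_x (u n x) ^+ 2 <= K.

Let D n x : R := `|u n.+1 x - u n x|.

Let mu_ n : measurable_fun setT (u n). Proof. exact: (u2 n).1. Qed.

Let mD n : measurable_fun setT (D n).
Proof. by apply: measurableT_comp => //; exact: measurable_funB. Qed.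

Let D0 n x : 0 <= D n x. Proof. exact: normr_ge0. Qed.

Let iD n : mu.-integrable setT (EFin \o D n).
Proof.
apply: (integrable_norm (f := fun x => u n.+1 x - u n x)).
exact/sqint_integrable/sqintB.
Qed.

(** Integrating the inequality below bounds the integral of [D n] by half of 2^n 4^-n + 2^-n mu(T),
    which is [c] times 2^-n. *)
Let c := (1 + fine (mu setT)) / 2.

(* AM-GM: 2 D <= 2^n D^2 + 2^-n *)
Let intD n : (\int[mu]_x (D n x)%:E <= (c * 2^-1 ^+ n)%:E)%E.
Proof.
have sD : sqint mu (fun x => u n.+1 x - u n x) by exact: sqintB.
rewrite -[leLHS]fineK; last exact: integrable_fin_num (iD n).
rewrite lee_fin -/(Rintegral mu setT (D n)).
pose g x := 2^-1 * 2 ^+ n * (u n.+1 x - u n x) ^+ 2 + 2^-1 * 2^-1 ^+ n.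
have ig1 : mu.-integrable setT (EFin \o (fun x => 2^-1 * 2 ^+ n * (u n.+1 x - u n x) ^+ 2)).
  by apply: RintegrableZ; exact: sD.2.
have ig2 : mu.-integrable setT (EFin \o (fun x : T => 2^-1 * 2^-1 ^+ n : R)).
  by apply: (sqint_integrable muT); exact: (sqint_cst muT).
apply: (@le_trans _ _ (\int[mu]_x g x)).
  apply: le_Rintegral => //; [exact: iD|exact: (RintegrableD ig1 ig2)|].
  move=> x _; rewrite /g /D -(real_normK (num_real (_ - _))).
  have p0 : 0 < 2 ^+ n :> R by rewrite exprn_gt0.
  rewrite exprVn; set a := `|_|; set p := 2 ^+ n in p0 *.
  have : 0 <= p^-1 * (p * a - 1) ^+ 2 by rewrite mulr_ge0 ?sqr_ge0// invr_ge0 ltW.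
  have -> : p^-1 * (p * a - 1) ^+ 2 = p * a ^+ 2 - 2 * a + p^-1.
    by field; rewrite gt_eqF.
  lra.
rewrite RintegralD// RintegralZl//; last exact: sD.2.
rewrite Rintegral_cst//.
have p0 : 0 < 2 ^+ n :> R by rewrite exprn_gt0.
have -> : c * 2^-1 ^+ n = 2^-1 * 2 ^+ n * 4^-1 ^+ n + 2^-1 * 2^-1 ^+ n * fine (mu setT).
  have -> : 4^-1 ^+ n = 2^-1 ^+ n * 2^-1 ^+ n :> R.
    by rewrite -exprMn; congr (_ ^+ n); field.
  by rewrite /c !exprVn; field; rewrite gt_eqF.
by rewrite lerD2r ler_wpM2l// mulr_ge0// ltW.
Qed.

(** The total variation of the sequence at a point. Its integral is at most the sum of the c 2^-n,
    so it is finite almost everywhere; where it is finite, the telescoping series of [u] converges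
    absolutely. *)
Let G x : \bar R := (\sum_(n <oo) (D n x)%:E)%E.

Let mG : measurable_fun setT G.
Proof. by apply: ge0_emeasurable_sum => [n x _ _|n _]; [rewrite lee_fin|exact/measurable_EFinP]. Qed.

Let G0 x : (0 <= G x)%E. Proof. by apply: nneseries_ge0 => n _ _; rewrite lee_fin. Qed.

Let iG : mu.-integrable setT G.
Proof.
apply/integrableP; split; first exact: mG.
under eq_integral do rewrite gee0_abs ?G0//.
rewrite /G integral_nneseries//; [|by move=> n; exact/measurable_EFinP|by move=> n x _; rewrite lee_fin].
apply: (@le_lt_trans _ _ (\sum_(n <oo) (c * 2^-1 ^+ n)%:E)%E).
  apply: lee_nneseries => n _; last exact: intD.
  by move=> _; apply: integral_ge0 => x _; rewrite lee_fin.
have h : series (geometric c 2^-1) @ \oo --> c * (1 - 2^-1)^-1.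
  by apply: cvg_geometric_series; rewrite ger0_norm// invf_lt1// ltr1n.
have -> : (\sum_(n <oo) (c * 2^-1 ^+ n)%:E = (c * (1 - 2^-1)^-1)%:E)%E.
  apply/cvg_lim => //.
  rewrite (_ : (fun n => _) = EFin \o series (geometric c 2^-1)); last first.
    by apply/funext => n /=; rewrite sumEFin.
  by apply: cvg_EFin h; exact: nearW.
exact: ltry.
Qed.

Let cvg_u x : (G x < +oo)%E -> cvgn (u ^~ x).
Proof.
move=> Gx; pose w n := u n.+1 x - u n x.
have cw : cvgn (series w).
  apply: normed_cvg; apply: nondecreasing_is_cvgn.
    apply/nondecreasing_seqP => n.
    have -> : [normed series w] n.+1 = [normed series w] n + `|w n|.
      exact: big_nat_recr.
    by rewrite lerDl.
  exists (fine (G x)) => _ [n _ <-]; rewrite -lee_fin fineK ?ge0_fin_numE//.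
  rewrite [[normed series w] n](_ : _ = \sum_(0 <= i < n) D i x)//.
  by rewrite -sumEFin; apply: nneseries_lim_ge => i _; rewrite lee_fin.
have -> : u ^~ x = fun n => u 0%N x + series w n.
  by apply/funext => n; rewrite /series/= telescope_sumr//; ring.
by apply: is_cvgD => //; exact: is_cvg_cst.
Qed.

Let E := [set x | (G x < +oo)%E].

Let mE : measurable E.
Proof. by rewrite /E -[X in measurable X]setTI; exact: emeasurable_fun_infty_o. Qed.

(** The factor [\1_E] makes the sequence converge at every point, so that the limit is
    measurable. *)
Let v x := limn (fun n => u n x * \1_E x).

Let v_cvg x : (fun n => u n x * \1_E x) @ \oo --> v x.
Proof.
rewrite /v; have [xE|xE] := pselect (E x).
  rewrite indicE mem_set//=; under eq_fun do rewrite mulr1.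
  exact: cvg_u.
rewrite indicE memNset//=; under eq_fun do rewrite mulr0.
exact: is_cvg_cst.
Qed.

Let mv : measurable_fun setT v.
Proof.
apply: (@measurable_fun_cvg _ _ _ _ (fun n x => u n x * \1_E x)) => // n.
by apply: measurable_funM => //; exact: measurable_indic.
Qed.

Let ae_E : {ae mu, forall x, E x}.
Proof.
by apply: filterS (integrable_ae measurableT iG) => x /(_ I); rewrite /E/= ge0_fin_numE.
Qed.

Let ae_cvg : {ae mu, forall x, u ^~ x @ \oo --> v x}.
Proof.
apply: filterS ae_E => x Ex; have := @v_cvg x.
by rewrite indicE mem_set//=; under eq_fun do rewrite mulr1.
Qed.

Let u_dom n x : (`|u n x|%:E <= `|u 0%N x|%:E + G x)%E.
Proof.
have [] := ltP (G x) +oo%E => [Gx|]; last by rewrite leye_eq => /eqP ->; rewrite addey ?leey.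
apply: (@le_trans _ _ (`|u 0%N x|%:E + \sum_(0 <= i < n) (D i x)%:E)%E); last first.
  by rewrite leeD2l//; apply: nneseries_lim_ge => i _; rewrite lee_fin.
rewrite sumEFin -EFinD lee_fin.
elim: n => [|n ih]; first by rewrite big_nil addr0.
rewrite big_nat_recr//= addrA.
have -> : u n.+1 x = u n x + (u n.+1 x - u n x) by ring.
by apply: le_trans (ler_normD _ _) _; rewrite lerD2r.
Qed.

(** Fatou's lemma bounds the norm of the limit. The convergence of the pairings is dominated
    convergence, with majorant |M| (|u_0| + G). *)
Lemma sqint_limit : exists v, [/\ sqint mu v,
  (\int[mu]_x v x ^+ 2 <= K) &
  forall psi, measurable_fun setT psi -> ae_bounded mu psi ->
    \int[mu]_x (u n x * psi x) @[n --> \oo] --> \int[mu]_x (v x * psi x)].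
Proof.
have v2 : (\int[mu]_x (v x ^+ 2)%:E <= K%:E)%E.
  pose w n x := (u n x * \1_E x) ^+ 2.
  have mw n : measurable_fun setT (EFin \o w n).
    apply/measurable_EFinP; apply: measurable_funX.
    by apply: measurable_funM => //; exact: measurable_indic.
  have -> : (\int[mu]_x (v x ^+ 2)%:E = \int[mu]_x limn_einf (fun n => (w n x)%:E))%E.
    apply: eq_integral => x _; apply/esym; apply: (cvg_limn_einf_sup _).1.
    apply: cvg_EFin; first exact: nearW.
    rewrite /comp /= expr2; under eq_fun do rewrite /w expr2.
    exact: cvgM (@v_cvg x) (@v_cvg x).
  apply: le_trans (fatou _ _ _ _) _ => //.
    by move=> n x _; rewrite lee_fin sqr_ge0.
  rewrite limn_einf_lim; apply: lime_le; first exact: is_cvg_einfs.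
  apply: nearW => n; apply: (@le_trans _ _ (\int[mu]_x (w n x)%:E)%E).
    by apply: ereal_inf_lbound; exists n => /=.
  apply: (@le_trans _ _ (\int[mu]_x (u n x ^+ 2)%:E)%E).
    apply: ge0_le_integral => //.
    - by move=> x _; rewrite lee_fin sqr_ge0.
    - exact: mw.
    - by apply/measurable_EFinP; exact: measurable_funX.
    - move=> x _; rewrite lee_fin /w exprMn indicE ler_piMr ?sqr_ge0//.
      by case: (x \in E); rewrite ?expr1n// expr0n.
  rewrite -[leLHS]fineK; last exact: integrable_fin_num (u2 n).2.
  by rewrite lee_fin; exact: u_bound.
have sv : sqint mu v.
  split => //; apply/integrableP; split.
    by apply/measurable_EFinP; exact: measurable_funX.
  under eq_integral do rewrite gee0_abs ?lee_fin ?sqr_ge0//.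
  exact: le_lt_trans v2 (ltry _).
exists v; split => //.
  rewrite -lee_fin fineK//; exact: integrable_fin_num sv.2.
move=> psi mpsi [M psiM].
have iu0 : mu.-integrable setT (EFin \o (fun x => `|u 0%N x|)).
  by apply: (integrable_norm (f := u 0%N)); exact/sqint_integrable.
apply: (@Rdominated_convergence _ _ _ mu _ _
    (fun x => `|M|%:E * (`|u 0%N x|%:E + G x))%E).
- by move=> n; exact: measurable_funM.
- exact: measurable_funM.
- by apply: filterS ae_cvg => x ux; exact: cvgMl.
- by apply: integrableZl => //; exact: integrableD.
- apply: filterS psiM => x px n.
  rewrite normrM mulrC EFinM lee_pmul// ?lee_fin//.
  by rewrite (le_trans px) ?ler_norm.
Qed.

End square_integrable_limit.

(** * Integration over the cell *)

(** The complement of [D] is null for the restricted measure, and the two measures agree on subsets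
    of [D]. Splitting into positive and negative parts reduces to nonnegative functions. *)
Lemma integral_mrestr (dd : measure_display) (T : measurableType dd)
    (R : realType) (mu : {measure set T -> \bar R}) (D : set T)
    (mD : measurable D) (f : T -> \bar R) : measurable_fun setT f ->
  (\int[mrestr mu mD]_x f x = \int[mu]_(x in D) f x)%E.
Proof.
suff ge0_case g : measurable_fun setT g -> (forall x, (0 <= g x)%E) ->
    (\int[mrestr mu mD]_x g x = \int[mu]_(x in D) g x)%E.
  move=> mf; rewrite [LHS]integralE [RHS]integralE; congr (_ - _)%E.
    by apply: ge0_case => //; exact: measurable_funepos.
  by apply: ge0_case => //; exact: measurable_funeneg.
move=> mg g0.
rewrite (@ge0_negligible_integral _ _ _ (mrestr mu mD) setT (~` D))//.
- rewrite setTD setCK; apply: eq_measure_integral => A mA AD /=.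
  by rewrite /mrestr (setIidl AD).
- exact: measurableC.
- by rewrite /= /mrestr setICl measure0.
Qed.

Section cell_integral.
Context {R : realType}.

Definition tail_row n (L : 'rV[R]_n.+1) : 'rV[R]_n := \row_i L ord0 (lift ord0 i).

Definition update n (x : points R n) (j : 'I_n) (t : R) : points R n :=
  [tuple (if i == j then t else tnth x i) | i < n].

Lemma pair_cons_cell n (L : 'rV[R]_n.+1) :
  @pair_cons R n @^-1` cell L = `[0, L ord0 ord0[ `*` cell (tail_row L).
Proof.
apply/seteqP; split => [[t y] /= ty|[t y] /= [+ cy]].
  split; first by have := ty ord0; rewrite tnth0 in_itv.
  by move=> i; have := ty (lift ord0 i); rewrite tnthS mxE.
rewrite in_itv/= => tL i; case: (unliftP ord0 i) => [j|] ->.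
  by rewrite tnthS; have := cy j; rewrite mxE.
by rewrite tnth0.
Qed.

Lemma tuple_lebesgue_cell n (L : 'rV[R]_n) : (forall i, 0 < L ord0 i) ->
  tuple_lebesgue R n (cell L) = (\prod_i L ord0 i)%:E.
Proof.
elim: n L => [|n ih] L hL.
  rewrite big_ord0 /= diracE mem_set//; first by case.
rewrite /= /cons_measure /pushforward pair_cons_cell.
rewrite product_measure1E//; last exact: measurable_cell.
rewrite ih; last by move=> i; rewrite mxE.
have l0 : @lebesgue_measure R `[0, L ord0 ord0[%classic = (L ord0 ord0)%:E.
  by rewrite lebesgue_measure_itv/= lte_fin hL sube0.
rewrite [X in (X * _)%E]l0 -EFinM big_ord_recl.
by congr (_ * _)%:E; apply: eq_bigr => i _; rewrite mxE.
Qed.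

Lemma update_cons0 n (t s : R) (y : points R n) :
  update (pair_cons (t, y)) ord0 s = pair_cons (s, y).
Proof.
apply: eq_from_tnth => i; rewrite tnth_mktuple; case: (unliftP ord0 i) => [j|] ->.
  by rewrite -[_ == ord0]/false !tnthS.
by rewrite eqxx tnth0.
Qed.

Lemma update_consS n (t s : R) (y : points R n) j :
  update (pair_cons (t, y)) (lift ord0 j) s = pair_cons (t, update y j s).
Proof.
apply: eq_from_tnth => i; rewrite tnth_mktuple; case: (unliftP ord0 i) => [k|] ->.
  by rewrite !tnthS tnth_mktuple (inj_eq lift_inj).
by rewrite !tnth0.
Qed.

(** Fubini's theorem in whichever order makes the inner integral vanish, by induction along the
    recursive construction of [tuple_lebesgue]. The bound on [f] provides integrability on the
    product. *)
Lemma integral_cell_eq0 n (L : 'rV[R]_n) (f : points R n -> R) (j : 'I_n) :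
  (forall i, 0 < L ord0 i) ->
  measurable_fun setT f ->
  (exists M : R, forall x, cell L x -> `|f x| <= M) ->
  (forall x, \int[lebesgue_measure]_(t in `[0%R, L ord0 j[) (f (update x j t))%:E = 0)%E ->
  (\int[tuple_lebesgue R n]_(x in cell L) (f x)%:E = 0)%E.
Proof.
elim: n L f j => [|n ih] L f j hL mf [M fM] f0; first by case: j {f0}.
pose D : set (measurableTypeR R * points R n) := `[0, L ord0 ord0[ `*` cell (tail_row L).
have DE : @pair_cons R n @^-1` cell L = D by exact: pair_cons_cell.
pose g : measurableTypeR R * points R n -> \bar R :=
  (fun z => (f (pair_cons z))%:E) \_ D.
have mD : measurable D.
  by apply: measurableX => //; exact: measurable_cell.
have muD : ((@lebesgue_measure R \x tuple_lebesgue R n) D < +oo)%E.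
  have := tuple_lebesgue_cell hL; rewrite /= /cons_measure /pushforward DE => ->.
  exact: ltry.
have mfc : measurable_fun setT (f \o @pair_cons R n).
  by apply: measurableT_comp => //; exact: measurable_pair_cons.
have iD : (@lebesgue_measure R \x tuple_lebesgue R n)%E.-integrable D
    (EFin \o (f \o @pair_cons R n)).
  apply: measurable_bounded_integrable => //; first exact: measurable_funTS.
  exists M; split; first exact: num_real.
  move=> N MN z /= zD; apply: le_trans (ltW MN).
  by apply: fM; move: zD; rewrite -DE.
have ig : (@lebesgue_measure R \x tuple_lebesgue R n)%E.-integrable setT g.
  exact/(integrable_mkcond _ mD).
have -> : (\int[tuple_lebesgue R n.+1]_(x in cell L) (f x)%:E =
   \int[@lebesgue_measure R \x tuple_lebesgue R n]_z g z)%E.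
  rewrite /g -integral_mkcond -DE.
  rewrite (@integral_pushforward _ _ _ _ _ (@pair_cons R n) _ _ (cell L))//.
  - exact: measurable_pair_cons.
  - exact/measurable_EFinP.
  - by rewrite DE.
  - exact: measurable_cell.
case: (unliftP ord0 j) f0 => [k ->|->] f0.
  (* The direction [j] lies in the tail: freeze the first coordinate and use the induction
     hypothesis on the rest. *)
  rewrite -(integral12_prod_meas1 ig) /fubini_F.
  apply: integral0_eq => t _.
  have [tL|tL] := boolP (t \in `[0, L ord0 ord0[).
    rewrite (_ : \int[_]_y _ = \int[tuple_lebesgue R n]_(y in cell (tail_row L)) (f (pair_cons (t, y)))%:E)%E.
      apply: (ih _ _ k).
      - by move=> i; rewrite mxE.
      - by apply: measurableT_comp mfc _; exact: pair1_measurable.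
      - exists M => y cy; apply: fM.
        by have : D (t, y) by []; rewrite -DE.
      - by move=> y; have := f0 (pair_cons (t, y)); rewrite mxE; under eq_integral do rewrite update_consS.
    rewrite [RHS]integral_mkcond; apply: eq_integral => y _.
    rewrite /g !patchE; congr (if _ then _ else _).
    by apply/idP/idP; rewrite !inE => // -[].
  apply: integral0_eq => y _; rewrite /g patchE memNset// => -[/= tL' _].
  by rewrite tL' in tL.
(* The direction [j] is the first coordinate: integrate over it first. *)
rewrite -(integral21_prod_meas1 ig) /fubini_G.
apply: integral0_eq => y _.
have [yL|yL] := pselect (cell (tail_row L) y); last first.
  by apply: integral0_eq => t _; rewrite /g patchE memNset// => -[].
rewrite -(f0 (pair_cons (0, y))) [RHS]integral_mkcond; apply: eq_integral => t _.
rewrite /g !patchE update_cons0; congr (if _ then _ else _).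
by apply/idP/idP; rewrite !inE => // -[].
Qed.

End cell_integral.

(** * Continuous functions are measurable on tuples and bounded on the cell *)

Section continuous_on_points.
Context {R : realType} {d : nat}.

(** The sigma-algebra on tuples is generated by the coordinates, not by the open sets. The bridge is
    that an open set is a countable union of boxes with rational corners. *)
Lemma measurable_open_vec (U : set 'rV[R]_d) : open U ->
  measurable (@vec R d @^-1` U).
Proof.
move=> oU.
pose box (p : 'rV[rat * rat]_d) := [set x : points R d |
  forall i, ratr (p ord0 i).1 < tnth x i < ratr (p ord0 i).2].
have mbox p : measurable (box p).
  rewrite (_ : box p =
  \big[setI/setT]_(i < d) ((@tnth d _)^~ i @^-1` `]ratr (p ord0 i).1, ratr (p ord0 i).2[)).
    apply: bigsetI_measurable => i _.
    rewrite -[X in measurable X]setTI; apply: measurable_tnth => //.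
  apply/seteqP; split => x /=.
    by move=> Lx; rewrite -bigcap_seq => i _ /=; rewrite in_itv/=; exact: Lx.
  rewrite -bigcap_seq => Lx i.
  by have := Lx i; rewrite /= mem_index_enum in_itv; exact.
(* Ranging over all rational corners, with the empty set in place of boxes not contained in [U],
   keeps the index type countable. *)
have -> : vec @^-1` U = \bigcup_(p : 'rV[rat * rat]_d)
    (if `[< box p `<=` vec @^-1` U >] then box p else set0).
  apply/seteqP; split => [x Ux|x [p _]]; last by case: asboolP => // pU /pU.
  have /nbhs_ballP[e /= e0 eU] : nbhs (vec x) U by exact: open_nbhs_nbhs.
  have lo i : {q : rat | ratr q \in `]tnth x i - e, tnth x i[}.
    by apply: cid; apply: rat_in_itvoo; rewrite ltrBlDr ltrDl.
  have hi i : {q : rat | ratr q \in `]tnth x i, tnth x i + e[}.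
    by apply: cid; apply: rat_in_itvoo; rewrite ltrDl.
  exists (\row_i (sval (lo i), sval (hi i))) => //.
  rewrite ifT.
    move=> i; rewrite mxE /=; case: (lo i) (hi i) => q /= + [q' /=].
    by rewrite !in_itv/= => /andP[_ ->] /andP[->].
  apply/asboolP => y yb; apply: eU; split => // i j.
  rewrite ord1 !mxE; have := yb j; rewrite mxE /=; case: (lo j) (hi j) => q /= + [q' /=].
  rewrite !in_itv/= => /andP[h1 h2] /andP[h3 h4] /andP[h5 h6].
  rewrite /ball/= ltr_distlC; apply/andP; split.
    by apply: lt_trans h5.
  by apply: lt_trans h4.
apply: countable_bigcupT_measurable; first exact: countableP.
by move=> p; case: ifP.
Qed.

Lemma measurable_continuous_vec (phi : 'rV[R]_d -> R) : continuous phi ->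
  measurable_fun setT (phi \o @vec R d).
Proof.
move=> cphi; apply: (measurability _ (RGenOpens.measurableE R)).
move=> _ [_ [a [b ->]] <-]; rewrite setTI comp_preimage.
by apply: measurable_open_vec; apply: open_comp => // x _; exact: cphi.
Qed.

Lemma bounded_cell (L : 'rV[R]_d) (phi : 'rV[R]_d -> R) : continuous phi ->
  exists M, forall x, cell L x -> `|phi (vec x)| <= M.
Proof.
move=> cphi.
have cK : compact [set y : 'rV[R]_d | forall i, `[0, L ord0 i]%classic (y ord0 i)].
  apply: (@rV_compact R d (fun i => `[0, L ord0 i]%classic)) => i.
  exact: segment_compact.
have /compact_bounded[M [_ hM]] :
  compact (phi @` [set y : 'rV[R]_d | forall i, `[0, L ord0 i]%classic (y ord0 i)]).
  by apply: continuous_compact => //; exact: continuous_subspaceT.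
exists (M + 1) => x cx; apply: hM; first by rewrite ltrDl.
exists (vec x) => // i; rewrite /= mxE in_itv/=.
by have /andP[-> /ltW ->] := cx i.
Qed.

End continuous_on_points.

(** * Derivatives of periodic functions integrate to zero *)

Section torus_integration_by_parts.
Context {R : realType} {d : nat}.
Variables (L : 'rV[R]_d) (hL : forall i, 0 < L ord0 i).
Implicit Types phi psi : 'rV[R]_d -> R.
Notation e_ := (@delta_mx R 1 d ord0).

Lemma vec_update (x : points R d) j t :
  vec (update x j t) = vec (update x j 0) + t *: e_ j.
Proof.
apply/rowP => i; rewrite !mxE !tnth_mktuple eqxx/=.
by case: eqVneq => _; rewrite ?add0r ?mulr1 ?mulr0 ?addr0.
Qed.

(** On each line in direction [j] the fundamental theorem of calculus yields the difference of [phi]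
    across one period, which is zero; Fubini's theorem does the rest. *)
Lemma integral_partial_eq0 phi j :
  continuous phi -> (forall y, derivable phi y (e_ j)) ->
  continuous (partial j phi) -> (forall y, phi (y + L ord0 j *: e_ j) = phi y) ->
  \int[torus L]_x partial j phi (vec x) = 0.
Proof.
move=> cphi dphi cdphi per.
have mf := measurable_continuous_vec cdphi.
rewrite /Rintegral /torus integral_mrestr; last exact/measurable_EFinP.
rewrite (@integral_cell_eq0 _ _ L (partial j phi \o @vec R d) j)//; first exact: bounded_cell.
move=> x; pose y0 := vec (update x j 0).
pose G t := phi (y0 + t *: e_ j); pose g t := partial j phi (y0 + t *: e_ j).
have cline : continuous (fun t : R => y0 + t *: e_ j).
  by move=> t; apply: cvgD; [exact: cvg_cst|exact: cvgZl].
have cG : continuous G by move=> t; apply: continuous_comp; [exact: cline|exact: cphi].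
have cg : continuous g by move=> t; apply: continuous_comp; [exact: cline|exact: cdphi].
(* The difference quotients of [G] coincide with those of [phi] along [e_ j], so derivability and
   the value of the derivative carry over to one variable. *)
have quot t : (fun h => h^-1 *: (G (h *: 1 + t) - G t)) =
    (fun h => h^-1 *: (phi (h *: e_ j + (y0 + t *: e_ j)) - phi (y0 + t *: e_ j))).
  by apply/funext => h; rewrite /G scalerDl addrCA [h *: 1]mulr1.
have -> : (\int[lebesgue_measure]_(t in `[0%R, L ord0 j[) ((partial j phi \o @vec R d) (update x j t))%:E =
    \int[lebesgue_measure]_(t in `[0%R, L ord0 j]) (g t)%:E)%E.
  transitivity (\int[lebesgue_measure]_(t in `[0%R, L ord0 j[) (g t)%:E)%E.
    by apply: eq_integral => t _; rewrite /= vec_update.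
  apply: integral_itv_bndo_bndc; apply/measurable_EFinP; apply: measurable_funTS.
  exact: continuous_measurable_fun.
rewrite (@continuous_FTC2 _ g G)//.
- by rewrite -EFinB /G per scale0r addr0 subrr.
- exact: continuous_subspaceT.
- split.
  + by move=> t _; rewrite /derivable quot; exact: dphi.
  + exact/cvg_at_right_filter/cG.
  + exact/cvg_at_left_filter/cG.
- by move=> t _; rewrite derive1E /derive quot.
Qed.

End torus_integration_by_parts.

(** * Trigonometric modes *)

(** The difference quotients coincide, so the one-variable rules for derivatives can be applied
    along a line. *)
Lemma is_derive_line {R : realType} {V : normedModType R} (phi : V -> R) (y v : V) l :
  is_derive (0 : R) 1 (fun t => phi (y + t *: v)) l -> is_derive y v phi l.
Proof.
set G := fun t => _.
have quot : (fun h : R => h^-1 *: (phi (h *: v + y) - phi y)) =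
    (fun h => h^-1 *: (G (h *: 1 + 0) - G 0)).
  by apply/funext => h; rewrite /G addr0 scale0r addr0 [h *: 1]mulr1 [y + _]addrC.
by case=> dG vG; split; [rewrite /derivable quot|rewrite /derive quot].
Qed.

Section integer_shift.
Context {R : realType}.

Lemma cos_sinDint (t : R) (m : int) :
  cos (t + 2 * pi * m%:~R) = cos t /\ sin (t + 2 * pi * m%:~R) = sin t.
Proof.
have shift (n : nat) (s : R) : cos (s + 2 * pi * n%:R) = cos s /\ sin (s + 2 * pi * n%:R) = sin s.
  rewrite (_ : 2 * pi * n%:R = (pi *+ 2) *+ n); last by rewrite mulr_natr mulr_natl.
  by rewrite (periodicn (@cosD2pi R)) (periodicn (@sinD2pi R)).
case: m => n; first exact: shift.
have := shift n.+1 (t + 2 * pi * (Negz n)%:~R).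
by rewrite NegzE rmorphN/= mulrN addrNK => -[-> ->].
Qed.

End integer_shift.

Section trigonometric_modes.
Context {R : realType} {d : nat}.
Variables (L : 'rV[R]_d) (hL : forall i, 0 < L ord0 i).
Implicit Types (k l : 'rV[int]_d) (y : 'rV[R]_d).
Notation e_ := (@delta_mx R 1 d ord0).

Definition theta k y : R := 2 * pi * dot (freq L k) y.

Definition wavenumber k j : R := 2 * pi * freq L k ord0 j.

(** Keeping both amplitudes makes the family at a fixed [k] stable under all partial derivatives,
    which is how smoothness is obtained. *)
Definition trig (a b : R) k y : R := a * cos (theta k y) + b * sin (theta k y).

Lemma dotDr (u v w : 'rV[R]_d) : dot u (v + w) = dot u v + dot u w.
Proof. by rewrite /dot -big_split; apply: eq_bigr => i _; rewrite mxE mulrDr. Qed.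

Lemma dotDl (u v w : 'rV[R]_d) : dot (u + v) w = dot u w + dot v w.
Proof. by rewrite /dot -big_split; apply: eq_bigr => i _; rewrite mxE mulrDl. Qed.

Lemma dotNl (u w : 'rV[R]_d) : dot (- u) w = - dot u w.
Proof. by rewrite /dot -sumrN; apply: eq_bigr => i _; rewrite mxE mulNr. Qed.

Lemma dotC (u w : 'rV[R]_d) : dot u w = dot w u.
Proof. by apply: eq_bigr => i _; rewrite mulrC. Qed.

Lemma dot_delta (u : 'rV[R]_d) j t : dot u (t *: e_ j) = t * u ord0 j.
Proof.
rewrite /dot (bigD1 j)//= big1 => [|i ij].
  by rewrite !mxE !eqxx mulr1 addr0 mulrC.
by rewrite !mxE eqxx (negbTE ij) !mulr0.
Qed.

Lemma continuous_dot (u : 'rV[R]_d) : continuous (dot u).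
Proof.
have := @continuous_big R 'I_d +%R 0 xpredT (@add_continuous R) _
  (index_enum 'I_d) (fun i (w : 'rV[R]_d) => u ord0 i * w ord0 i).
by apply => i _ w; apply: (@cvgMr _ _ (nbhs w)); exact: (@coord_continuous R 1 d ord0 i w).
Qed.

Lemma freqD k l : freq L (k + l) = freq L k + freq L l.
Proof. by apply/rowP => i; rewrite !mxE rmorphD/= mulrDl. Qed.

Lemma freqN k : freq L (- k) = - freq L k.
Proof. by apply/rowP => i; rewrite !mxE rmorphN/= mulNr. Qed.

Lemma freq0 : freq L 0 = 0.
Proof. by apply/rowP => i; rewrite !mxE mul0r. Qed.

Lemma thetaD k l y : theta (k + l) y = theta k y + theta l y.
Proof. by rewrite /theta freqD dotDl mulrDr. Qed.

Lemma thetaN k y : theta (- k) y = - theta k y.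
Proof. by rewrite /theta freqN dotNl mulrN. Qed.

Lemma theta0 y : theta 0 y = 0.
Proof. by have := thetaD 0 0 y; rewrite addr0 -[LHS]addr0 => /addrI. Qed.

Lemma theta_line k y j t : theta k (y + t *: e_ j) = theta k y + t * wavenumber k j.
Proof. by rewrite /theta dotDr mulrDr dot_delta mulrCA. Qed.

Lemma is_derive_trig a b k y j : is_derive y (e_ j) (trig a b k)
  (trig (b * wavenumber k j) (- (a * wavenumber k j)) k y).
Proof.
apply: is_derive_line; rewrite /trig; set c := wavenumber k j.
under eq_fun do rewrite theta_line -/c.
have dl : is_derive (0 : R) 1 (fun t => theta k y + t * c) c.
  by apply: is_derive_eq; rewrite scaler0 !add0r mul1r [_%:A]mulr1.
apply: is_derive_eq.
by rewrite !mul0r !addr0 ![_ *: _]mulrC; ring.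
Qed.

Lemma partial_trig a b k j : partial j (trig a b k) =
  trig (b * wavenumber k j) (- (a * wavenumber k j)) k.
Proof. by apply/funext => y; exact: (@derive_val _ _ _ _ _ _ _ (is_derive_trig a b k y j)). Qed.

Lemma continuous_trig a b k : continuous (trig a b k).
Proof.
have ct : continuous (theta k).
  move=> y; apply: (@cvgMr _ _ (nbhs y)); exact: (@continuous_dot (freq L k) y).
have cc : continuous (cos \o theta k).
  by move=> y; apply: continuous_comp; [exact: ct|exact: continuous_cos].
have cs : continuous (sin \o theta k).
  by move=> y; apply: continuous_comp; [exact: ct|exact: continuous_sin].
move=> y; apply: (@cvgD _ _ _ (nbhs y)); apply: (@cvgMr _ _ (nbhs y)).
- exact: (cc y).
- exact: (cs y).
Qed.

Lemma smooth_trig a b k : smooth (trig a b k).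
Proof.
move=> s f; have [a' [b' ->]] : exists a' b', f = trig a' b' k.
  rewrite {}/f; elim: s => [|j s [a' [b' ih]]]; first by exists a, b.
  by rewrite /= ih partial_trig; eexists; eexists.
split; first exact: continuous_trig.
by move=> i y; have [] := is_derive_trig a' b' k y i.
Qed.

Lemma trig_periodic a b k i y : trig a b k (y + L ord0 i *: e_ i) = trig a b k y.
Proof.
rewrite /trig theta_line /wavenumber mxE.
have -> : L ord0 i * (2 * pi * ((k ord0 i)%:~R / L ord0 i)) = 2 * pi * (k ord0 i)%:~R.
  by field; rewrite gt_eqF.
by have [-> ->] := cos_sinDint (theta k y) (k ord0 i).
Qed.

Lemma test_trig a b k : test L (trig a b k).
Proof. by split; [exact: smooth_trig|move=> i y; exact: trig_periodic]. Qed.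

Lemma test_continuous phi : test L phi -> continuous phi.
Proof. by move=> [/(_ [::])[]]. Qed.

Lemma test_derivable phi j y : test L phi -> derivable phi y (e_ j).
Proof. by move=> [/(_ [::])[_]]. Qed.

Lemma test_continuous_partial phi j : test L phi -> continuous (partial j phi).
Proof. by move=> [/(_ [:: j])[]]. Qed.

Lemma torus_volume : torus L setT = (\prod_i L ord0 i)%:E.
Proof. by rewrite /torus /= /mrestr setTI tuple_lebesgue_cell. Qed.

Lemma torus_lty : (torus L setT < +oo)%E.
Proof. by rewrite torus_volume ltry. Qed.

Lemma ae_cell : {ae torus L, forall x, cell L x}.
Proof.
exists (~` cell L); split; last exact: subset_refl.
  by apply: measurableC; exact: measurable_cell.
by rewrite /torus /= /mrestr setICl measure0.
Qed.

Lemma bounded_continuous_vec phi : continuous phi -> ae_bounded (torus L) (phi \o vec).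
Proof.
move=> /(bounded_cell L)[M hM]; exists M.
by apply: filterS ae_cell => x /hM.
Qed.

Lemma sqint_continuous phi : continuous phi -> sqint (torus L) (phi \o vec).
Proof.
move=> cphi; apply: (sqint_bounded torus_lty).
  exact: measurable_continuous_vec.
exact: bounded_continuous_vec.
Qed.

(** The product of [phi] with the mode is periodic, so its partial derivative integrates to zero;
    expand it by the product rule. *)
Lemma integral_partial_trig phi a b k j : test L phi ->
  \int[torus L]_x (partial j phi (vec x) * trig a b k (vec x)) =
  - \int[torus L]_x (phi (vec x) * partial j (trig a b k) (vec x)).
Proof.
move=> tphi.
have cphi := test_continuous tphi; have cdphi := @test_continuous_partial phi j tphi.
have dM y : is_derive y (e_ j) (phi * trig a b k)
    (phi y * partial j (trig a b k) y + trig a b k y * partial j phi y).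
  apply: is_deriveM; apply: DeriveDef => //; first exact: test_derivable.
  by have [] := is_derive_trig a b k y j.
have dME : partial j (phi * trig a b k) =
  fun y => phi y * partial j (trig a b k) y + partial j phi y * trig a b k y.
  by apply/funext => y; rewrite /partial derive_val [X in _ + X]mulrC.
have ct := @continuous_trig a b k.
have cpt : continuous (partial j (trig a b k)) by rewrite partial_trig; exact: continuous_trig.
have := @integral_partial_eq0 _ _ L hL (phi * trig a b k) j.
rewrite dME RintegralD//; last 2 first.
- exact: sqint_mul (sqint_continuous cphi) (sqint_continuous cpt).
- exact: sqint_mul (sqint_continuous cdphi) (sqint_continuous ct).
move=> ibp; apply/eqP; rewrite eq_sym -subr_eq0 -opprD oppr_eq0; apply/eqP.
apply: ibp.
- by move=> y; apply: (@cvgM _ _ (nbhs y)); [exact: cphi|exact: ct].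
- by move=> y; have [] := dM y.
- by move=> y; apply: (@cvgD _ _ _ (nbhs y)); apply: (@cvgM _ _ (nbhs y));
    [exact: cphi|exact: cpt|exact: cdphi|exact: ct].
- by move=> y; rewrite [LHS]/GRing.mul/= tphi.2 trig_periodic.
Qed.

Lemma wavenumber_neq0 k : k != 0 -> exists j, wavenumber k j != 0.
Proof.
move=> /eqP k0; apply/not_existsP => h; apply: k0; apply/rowP => j.
have /negP := h j; rewrite negbK /wavenumber mxE !mulf_eq0 invr_eq0 pnatr_eq0/=.
by rewrite (gt_eqF (pi_gt0 R)) (gt_eqF (hL j)) orbF intr_eq0 => /eqP ->; rewrite mxE.
Qed.

(** For [k != 0] some wave number is nonzero, and the mode is then itself a partial derivative of a
    periodic function in that direction. *)
Lemma integral_trig a b k :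
  \int[torus L]_x trig a b k (vec x) = if k == 0 then a * \prod_i L ord0 i else 0.
Proof.
have [->|/wavenumber_neq0[j cj]] := eqVneq.
  under eq_Rintegral do rewrite /trig theta0 cos0 sin0 mulr0 addr0 mulr1.
  by rewrite Rintegral_cst// torus_volume.
set c := wavenumber k j in cj.
rewrite (_ : trig a b k = partial j (trig (- b / c) (a / c) k)).
  rewrite integral_partial_eq0 //.
  - exact: continuous_trig.
  - by move=> y; have [] := is_derive_trig (- b / c) (a / c) k y j.
  - by rewrite partial_trig; exact: continuous_trig.
  - exact: trig_periodic.
rewrite partial_trig -/c; congr trig; first by field.
by field.
Qed.

End trigonometric_modes.

(** * Completeness of the trigonometric system *)

Section polynomial_step.
Context {R : realType}.
Implicit Types w z : R.

Lemma bernoulli_ineq z n : -1 <= z -> 1 + n%:R * z <= (1 + z) ^+ n.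
Proof.
move=> z1; elim: n => [|n ih]; first by rewrite mul0r addr0 expr0.
have z0 : 0 <= 1 + z by lra.
rewrite exprS; apply: le_trans (ler_wpM2l z0 ih).
rewrite -natr1; have : 0 <= n%:R * z ^+ 2 by rewrite mulr_ge0// sqr_ge0.
nra.
Qed.

(* The first factor tends to 1 below 1/2 and to 0 above; the second one only
   corrects the value at 1/2. *)
Definition step n w : R :=
  (1 - w ^+ n) ^+ (2 ^ n) * (1 - (1 - (w - 2^-1) ^+ 2) ^+ n).

Lemma step_itv n w : 0 <= w <= 1 -> 0 <= step n w <= 1.
Proof.
move=> /andP[w0 w1]; have u0 : 0 <= (w - 2^-1) ^+ 2 <= 1.
  by rewrite sqr_ge0/=; nra.
have h z m : 0 <= z <= 1 -> 0 <= 1 - z ^+ m <= 1.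
  by move=> /andP[z0 z1]; rewrite subr_ge0 exprn_ile1//= lerBlDr lerDl exprn_ge0.
have /andP[a0 a1] : 0 <= 1 - w ^+ n <= 1 by apply: h; rewrite w0.
have /andP[b0 b1] : 0 <= 1 - (1 - (w - 2^-1) ^+ 2) ^+ n <= 1 by apply: h; lra.
by rewrite /step mulr_ge0 ?exprn_ge0//= mulr_ile1 ?exprn_ge0// exprn_ile1.
Qed.

(** Below 1/2, Bernoulli's inequality bounds the first factor from below by 1 - (2w)^n. Above 1/2,
    (1 - w^n)(1 + w^n) <= 1 and Bernoulli's inequality for 1 + w^n bound it from above by (2w)^-n.
    At 1/2 the second factor vanishes identically. *)
Lemma step_cvg w : 0 <= w <= 1 ->
  step n w @[n --> \oo] --> (if w < 2^-1 then 1 else 0 : R).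
Proof.
move=> /andP[w0 w1].
have powE n : (2 ^ n)%:R * w ^+ n = (2 * w) ^+ n by rewrite exprMn natrX.
have wn n : 0 <= w ^+ n <= 1 by rewrite exprn_ge0// exprn_ile1.
have second : w != 2^-1 -> (1 - (1 - (w - 2^-1) ^+ 2) ^+ n) @[n --> \oo] --> (1 : R).
  move=> wN; rewrite -[X in _ --> X]subr0; apply: cvgB; first exact: cvg_cst.
  apply: cvg_expr.
  have : 0 < (w - 2^-1) ^+ 2 by rewrite lt_def sqr_ge0 sqrf_eq0 subr_eq0 wN.
  rewrite ltr_norml; have := sqr_ge0 w; nra.
have [wlt|wgt|->] := ltgtP w 2^-1.
- rewrite -[X in _ --> X]mulr1; apply: cvgM; last by apply: second; rewrite lt_eqF.
  apply: (@squeeze_cvgr _ _ _ _ (fun n => 1 - (2 * w) ^+ n) (cst 1)).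
  + apply: nearW => n; have /andP[wn0 wn1] := wn n; apply/andP; split.
      have := @bernoulli_ineq (- w ^+ n) (2 ^ n).
      by rewrite mulrN powE; apply; lra.
    by rewrite exprn_ile1//; lra.
  + rewrite -[X in _ --> X]subr0; apply: cvgB; first exact: cvg_cst.
    by apply: cvg_expr; rewrite ger0_norm ?mulr_ge0//; lra.
  + exact: cvg_cst.
- rewrite -[X in _ --> X](mulr1 0); apply: cvgM; last by apply: second; rewrite gt_eqF.
  apply: (@squeeze_cvgr _ _ _ _ (cst 0) (fun n => (2 * w)^-1 ^+ n)).
  + apply: nearW => n; have /andP[wn0 wn1] := wn n; apply/andP; split.
      by rewrite exprn_ge0//; lra.
    have p0 : 0 < (2 * w) ^+ n by rewrite exprn_gt0//; lra.
    rewrite exprVn -[leRHS]mul1r ler_pdivlMr//.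
    have : (1 - w ^+ n) ^+ (2 ^ n) * (1 + w ^+ n) ^+ (2 ^ n) <= 1.
      rewrite -exprMn exprn_ile1//; nra.
    apply: le_trans; apply: ler_wpM2l; first by rewrite exprn_ge0//; lra.
    have := @bernoulli_ineq (w ^+ n) (2 ^ n); rewrite powE => h; lra.
  + exact: cvg_cst.
  + have w2 : 1 < 2 * w by lra.
    have w2' : 0 < 2 * w by lra.
    by apply: cvg_expr; rewrite ger0_norm ?invr_ge0 ?(ltW w2')// invf_lt1.
- apply: cvg_near_cst; apply: nearW => n.
  by rewrite /step subrr expr0n subr0 expr1n subrr mulr0.
Qed.

End polynomial_step.

(** * The algebra of trigonometric polynomials and the sets it approximates *)

Section trigonometric_polynomials.
Context {R : realType} {d : nat}.
Variables (L : 'rV[R]_d) (hL : forall i, 0 < L ord0 i).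
Implicit Types (k l : 'rV[int]_d) (p q : points R d -> R).

Inductive trigpoly : (points R d -> R) -> Prop :=
| trigpoly_trig a b k : trigpoly (fun x => trig L a b k (vec x))
| trigpolyD p q : trigpoly p -> trigpoly q -> trigpoly (fun x => p x + q x).

Lemma trigpoly_cst c : trigpoly (cst c).
Proof.
have := trigpoly_trig c 0 0; congr trigpoly; apply/funext => x.
by rewrite /trig theta0 cos0 sin0 mulr0 addr0 mulr1.
Qed.

Lemma trigpoly_trigM a b k q : trigpoly q ->
  trigpoly (fun x => trig L a b k (vec x) * q x).
Proof.
elim=> [a' b' l|q1 q2 _ h1 _ h2]; last first.
  by under eq_fun do rewrite mulrDr; exact: trigpolyD.
(* The product-to-sum formulas, giving the frequencies [k + l] and [k - l]. *)
have := trigpolyD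
  (trigpoly_trig ((a * a' - b * b') / 2) ((a * b' + b * a') / 2) (k + l))
  (trigpoly_trig ((a * a' + b * b') / 2) ((b * a' - a * b') / 2) (k - l)).
congr trigpoly; apply/funext => x.
by rewrite /trig !thetaD !thetaN cosD sinD cosB sinB; field.
Qed.

Lemma trigpolyM p q : trigpoly p -> trigpoly q -> trigpoly (fun x => p x * q x).
Proof.
move=> tp tq; elim: tp => [a b k|p1 p2 _ h1 _ h2]; first exact: trigpoly_trigM.
by under eq_fun do rewrite mulrDl; exact: trigpolyD.
Qed.

Lemma trigpolyB p q : trigpoly p -> trigpoly q -> trigpoly (fun x => p x - q x).
Proof.
move=> tp tq; apply: trigpolyD => //.
by have := trigpolyM (trigpoly_cst (-1)) tq; under eq_fun do rewrite mulN1r.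
Qed.

Lemma trigpolyX p n : trigpoly p -> trigpoly (fun x => p x ^+ n).
Proof.
move=> tp; elim: n => [|n ih]; first exact: trigpoly_cst.
by under eq_fun do rewrite exprS; exact: trigpolyM.
Qed.

Lemma sqint_trigpoly p : trigpoly p -> sqint (torus L) p.
Proof.
elim=> [a b k|p1 p2 _ h1 _ h2]; last exact: sqintD.
apply: (sqint_continuous hL (phi := trig L a b k)); exact: continuous_trig.
Qed.

(** The bounds 0 and 1 survive complements and products, and later provide the domination for
    passing to the limit under the integral. Convergence is asked on the cell only, whose complement
    is null. *)
Definition trig_approximable (A : set (points R d)) :=
  exists p : nat -> points R d -> R,
    [/\ forall n, trigpoly (p n), forall n x, 0 <= p n x <= 1 &
        forall x, cell L x -> p n x @[n --> \oo] --> (\1_A x : R)].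

Lemma trig_approximable_eq A B : (forall x, cell L x -> A x <-> B x) ->
  trig_approximable A -> trig_approximable B.
Proof.
move=> AB [p [tp p01 pA]]; exists p; split => // x cx.
rewrite (_ : \1_B x = \1_A x); first exact: pA.
rewrite !indicE; congr (_%:R); congr nat_of_bool.
by apply/idP/idP; rewrite !inE => /AB; exact.
Qed.

Lemma trig_approximableC A : trig_approximable A -> trig_approximable (~` A).
Proof.
move=> [p [tp p01 pA]]; exists (fun n x => 1 - p n x); split.
- by move=> n; apply: trigpolyB => //; exact: trigpoly_cst.
- by move=> n x; have := p01 n x; lra.
- move=> x cx; rewrite (_ : \1__ x = 1 - \1_A x :> R); last first.
    by rewrite !indicE in_setC; case: (x \in A); rewrite /= ?subrr ?subr0.
  by apply: cvgB; [exact: cvg_cst|exact: pA].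
Qed.

Lemma trig_approximableI A B : trig_approximable A -> trig_approximable B ->
  trig_approximable (A `&` B).
Proof.
move=> [p [tp p01 pA]] [q [tq q01 qB]]; exists (fun n x => p n x * q n x); split.
- by move=> n; exact: trigpolyM.
- move=> n x; have /andP[p0 p1] := p01 n x; have /andP[q0 q1] := q01 n x.
  by rewrite mulr_ge0//= mulr_ile1.
- by move=> x cx; rewrite indicI /=; apply: cvgM; [exact: pA|exact: qB].
Qed.

(** The affine map w = 1/2 - u / (2M) sends [-M, M] into [0, 1] and turns u > 0 into w < 1/2; the
    polynomials [step n] in w are then trigonometric polynomials. *)
Lemma trig_approximable_gt0 u M : 0 < M -> trigpoly u -> (forall x, `|u x| <= M) ->
  trig_approximable [set x | 0 < u x].
Proof.
move=> M0 tu uM; pose w x := 2^-1 - (2 * M)^-1 * u x.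
have tw : trigpoly w.
  by apply: trigpolyB; [exact: trigpoly_cst|apply: trigpolyM => //; exact: trigpoly_cst].
have w01 x : 0 <= w x <= 1.
  have := uM x; rewrite ler_norml => /andP[uM1 uM2].
  have : -2^-1 <= (2 * M)^-1 * u x <= 2^-1.
    have M2 : 0 < 2 * M by rewrite mulr_gt0.
    by rewrite mulrC ler_pdivlMr// ler_pdivrMr//; lra.
  by rewrite /w; lra.
exists (fun n x => step n (w x)); split.
- move=> n; apply: trigpolyM.
    apply: trigpolyX; apply: trigpolyB; first exact: trigpoly_cst.
    exact: trigpolyX.
  apply: trigpolyB; first exact: trigpoly_cst.
  apply: trigpolyX; apply: trigpolyB; first exact: trigpoly_cst.
  by apply: trigpolyX; apply: trigpolyB => //; exact: trigpoly_cst.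
- by move=> n x; exact: step_itv.
- move=> x _; rewrite (_ : \1__ x = if w x < 2^-1 then 1 else 0); first exact: step_cvg.
  have -> : (w x < 2^-1) = (0 < u x).
    by rewrite /w ltrBlDr ltrDl pmulr_rgt0// invr_gt0 mulr_gt0.
  rewrite indicE; case: ifPn => [u0|u0]; first by rewrite mem_set.
  by rewrite memNset//; exact/negP.
Qed.

End trigonometric_polynomials.

(** * Arcs of the circle described by signs of sine and cosine *)

Section arcs.
Context {R : realType}.
Implicit Types t alpha : R.

Lemma sin_lt0_lowerhalf t : 0 <= t < 2 * pi -> (sin t < 0) = (pi < t).
Proof.
move=> /andP[t0 t2]; have [tpi|tpi] := ltP pi t.
  rewrite -[t](subrK pi) sinDpi oppr_lt0 sin_gt0_pi//; lra.
by apply/negbTE; rewrite -leNgt sin_ge0_pi// t0.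
Qed.

Lemma cos_lowerhalf t : cos (2 * pi - t) = cos t.
Proof. by rewrite cosB mulr_natl cos2pi sin2pi mul1r mul0r addr0. Qed.

(** A short arc is the part of the closed upper half circle, where cosine decreases, on which cosine
    exceeds its value at [alpha]. *)
Lemma arc_le_pi t alpha : 0 <= t < 2 * pi -> 0 < alpha <= pi ->
  t < alpha <-> (~ (0 < - sin t)) /\ 0 < cos t - cos alpha.
Proof.
move=> tI aI; rewrite oppr_gt0 sin_lt0_lowerhalf// subr_gt0.
split=> [ta|[/negP + ct]].
  by split; [apply/negP; lra|rewrite ltr_cos// in_itv/=; lra].
rewrite -leNgt => tpi; move: ct; rewrite ltr_cos// in_itv/=; lra.
Qed.

(** The complement of a long arc lies in the open lower half circle, where cosine increases, and is
    cut out there by cos t >= cos alpha. *)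
Lemma arc_gt_pi t alpha : 0 <= t < 2 * pi -> pi < alpha < 2 * pi ->
  t < alpha <-> ~ (0 < - sin t /\ ~ (0 < cos alpha - cos t)).
Proof.
move=> tI aI; rewrite oppr_gt0 sin_lt0_lowerhalf// subr_gt0.
have cosE : pi < t -> (cos t < cos alpha) = (t < alpha).
  move=> tpi; rewrite -(cos_lowerhalf t) -(cos_lowerhalf alpha) ltr_cos ?in_itv/=; [|lra|lra].
  by rewrite ltrD2l ltrN2.
split=> [ta [tpi]|h]; first by rewrite cosE.
have [tpi|tpi] := ltP pi t; last lra.
by rewrite -cosE//; apply: contrapT => ct; exact: h.
Qed.

End arcs.

(** * Generation of the sigma-algebra and completeness *)

Section completeness.
Context {R : realType} {d : nat}.
Variables (L : 'rV[R]_d) (hL : forall i, 0 < L ord0 i).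

Lemma theta_delta (j : 'I_d) (y : 'rV[R]_d) :
  theta L (delta_mx ord0 j) y = 2 * pi / L ord0 j * y ord0 j.
Proof.
rewrite /theta /dot (bigD1 j)//= big1 => [|i ij].
  by rewrite !mxE !eqxx addr0 mul1r mulrA.
by rewrite !mxE eqxx (negbTE ij) !mul0r.
Qed.

(** For the j-th unit vector as frequency, the phase of a point of the cell lies in [0, 2 pi) and is
    proportional to its j-th coordinate, so the ray becomes an arc. Rays with a <= 0 or a >= L_j are
    empty or everything on the cell. *)
Lemma trig_approximable_ray (j : 'I_d) a :
  trig_approximable L [set x | tnth x j < a].
Proof.
have approxT : trig_approximable L setT.
  exists (fun=> cst 1); split; first by move=> _; exact: trigpoly_cst.
    by move=> n x /=; rewrite lexx ler01.
  by move=> x _; rewrite indicT; exact: cvg_cst.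
have [a0|a0] := leP a 0.
  apply: trig_approximable_eq (trig_approximableC approxT) => x /(_ j)/andP[xj _].
  by split => [/(_ I)|xa]//; have := lt_le_trans xa a0; rewrite ltNge xj.
have [aL|aL] := leP (L ord0 j) a.
  apply: trig_approximable_eq approxT => x /(_ j)/andP[_ xj].
  by split => // _; exact: lt_le_trans aL.
pose k : 'rV[int]_d := delta_mx ord0 j.
pose alpha := 2 * pi / L ord0 j * a.
have q0 : 0 < 2 * pi / L ord0 j by rewrite divr_gt0// mulr_gt0// pi_gt0.
have qL : 2 * pi / L ord0 j * L ord0 j = 2 * pi by rewrite divfK// gt_eqF.
have tI x : cell L x -> 0 <= theta L k (vec x) < 2 * pi.
  move=> /(_ j)/andP[x0 xL]; rewrite theta_delta mxE.
  by apply/andP; split; [rewrite mulr_ge0// ltW|rewrite -[ltRHS]qL ltr_pM2l].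
have xa x : (tnth x j < a) = (theta L k (vec x) < alpha).
  by rewrite theta_delta mxE ltr_pM2l.
have aI : 0 < alpha < 2 * pi.
  by apply/andP; split; [rewrite mulr_gt0|rewrite -[ltRHS]qL ltr_pM2l].
have sE x : trig L 0 (-1) k (vec x) = - sin (theta L k (vec x)).
  by rewrite /trig mul0r add0r mulN1r.
have cE x : trig L 1 0 k (vec x) = cos (theta L k (vec x)).
  by rewrite /trig mul0r addr0 mul1r.
have appS : trig_approximable L [set x | 0 < - sin (theta L k (vec x))].
  under eq_set do rewrite -sE.
  apply: (trig_approximable_gt0 (M := 1)) => //; first exact: trigpoly_trig.
  by move=> x; rewrite sE normrN ler_norml sin_geN1 sin_le1.
have appC : trig_approximable L [set x | 0 < cos (theta L k (vec x)) - cos alpha].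
  under eq_set do rewrite -cE.
  apply: (trig_approximable_gt0 (M := 2)) => //.
    by apply: trigpolyB; [exact: trigpoly_trig|exact: trigpoly_cst].
  move=> x; rewrite cE ler_norml; have := cos_le1 (theta L k (vec x)).
  have := cos_geN1 (theta L k (vec x)); have := cos_le1 alpha; have := cos_geN1 alpha; lra.
have appC' : trig_approximable L [set x | 0 < cos alpha - cos (theta L k (vec x))].
  under eq_set do rewrite -cE.
  apply: (trig_approximable_gt0 (M := 2)) => //.
    by apply: trigpolyB; [exact: trigpoly_cst|exact: trigpoly_trig].
  move=> x; rewrite cE ler_norml; have := cos_le1 (theta L k (vec x)).
  have := cos_geN1 (theta L k (vec x)); have := cos_le1 alpha; have := cos_geN1 alpha; lra.
have [api|api] := leP alpha pi.
  apply: trig_approximable_eq (trig_approximableI (trig_approximableC appS) appC).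
  move=> x cx; rewrite /= xa; apply: iff_sym; apply: arc_le_pi; first exact: tI.
  by case/andP: aI => ->.
apply: trig_approximable_eq
  (trig_approximableC (trig_approximableI appS (trig_approximableC appC'))).
move=> x cx; rewrite /= xa; apply: iff_sym; apply: arc_gt_pi; first exact: tI.
by case/andP: aI => _ ->; rewrite api.
Qed.

Lemma measurable_trig_approximable : @measurable _ (points R d) =
  <<s [set A | measurable A /\ trig_approximable L A] >>.
Proof.
set G := [set A | _]; apply/seteqP; split; last first.
  by apply: smallest_sub; [exact: sigma_algebra_measurable|move=> A []].
(* The identity, with the generated sigma-algebra on its source, is tested for measurability
   coordinate by coordinate, where rays suffice. *)
suff mid : measurable_fun setT (id : g_sigma_algebraType G -> points R d).
  by move=> A mA; have := mid measurableT A mA; rewrite setTI.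
apply/measurable_fun_tnthP => j.
apply: (measurability _ (RGenInftyO.measurableE R)).
move=> _ [_ [a ->] <-]; rewrite setTI; apply: sub_sigma_algebra; split.
  by rewrite -[X in measurable X]setTI; apply: measurable_tnth => //.
rewrite (_ : _ @^-1` _ = [set x | tnth x j < a]); first exact: trig_approximable_ray.
by apply/seteqP; split => x /=; rewrite in_itv.
Qed.

Lemma integral_trigpoly_eq0 (f p : points R d -> R) : sqint (torus L) f ->
  (forall k a b, \int[torus L]_x (f x * trig L a b k (vec x)) = 0) ->
  trigpoly L p -> \int[torus L]_x (f x * p x) = 0.
Proof.
move=> sf f0; elim=> [a b k|p1 p2 tp1 h1 tp2 h2]; first exact: f0.
under eq_Rintegral do rewrite mulrDr.
by rewrite RintegralD ?h1 ?h2 ?addr0//; apply: sqint_mul => //; exact: sqint_trigpoly.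
Qed.

Lemma trig_complete (f : points R d -> R) : sqint (torus L) f ->
  (forall k a b, \int[torus L]_x (f x * trig L a b k (vec x)) = 0) ->
  ae_eq (torus L) setT f (cst 0).
Proof.
move=> sf f0.
have intf : (torus L).-integrable setT (EFin \o f).
  by apply: sqint_integrable sf; exact: torus_lty.
have approx_null A : measurable A -> trig_approximable L A ->
    (\int[torus L]_(x in A) (f x)%:E = 0)%E.
  move=> mA [p [tp p01 pA]].
  rewrite integral_mkcond.
  have fA : (EFin \o f) \_ A = EFin \o (fun x => f x * \1_A x).
    by apply/funext => x; rewrite patchE [RHS]/= indicE; case: ifP; rewrite ?mulr1 ?mulr0.
  rewrite fA -[LHS]fineK; last first.
    apply: integrable_fin_num => //; rewrite -fA.
    by apply/(integrable_mkcond _ mA); exact: integrableS intf.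
  congr EFin; have : \int[torus L]_x (f x * p n x) @[n --> \oo] -->
      \int[torus L]_x (f x * \1_A x).
    apply: (@Rdominated_convergence _ _ _ _ _ _ (fun x => `|f x|%:E)).
    - by move=> n; apply: measurable_funM; [exact: sf.1|exact: (sqint_trigpoly hL (tp n)).1].
    - by apply: measurable_funM; [exact: sf.1|exact: measurable_indic].
    - by apply: filterS (ae_cell L) => x cx; apply: cvgMr; exact: pA.
    - exact: integrable_norm intf.
    - apply: aeW => x n; have /andP[p0 p1] := p01 n x.
      by rewrite lee_fin normrM ler_piMr// ger0_norm.
  under eq_fun do rewrite integral_trigpoly_eq0//.
  move=> /(cvg_lim (@Rhausdorff R)) h.
  by apply: etrans (esym h) _; rewrite lim_cst.
(* The approximable measurable sets are stable under intersection, and the sets over which [f]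
   integrates to zero form a Dynkin system. *)
have null S : measurable S -> (\int[torus L]_(x in S) (f x)%:E = 0)%E.
  have nullT : (\int[torus L]_x (f x)%:E = 0)%E.
    apply: approx_null => //; exists (fun=> cst 1); split.
    - by move=> _; exact: trigpoly_cst.
    - by move=> n x /=; rewrite lexx ler01.
    - by move=> x _; rewrite indicT; exact: cvg_cst.
  move=> mS; have : <<s [set A | measurable A /\ trig_approximable L A] >> S.
    by rewrite -measurable_trig_approximable.
  move: S {mS}; apply: dynkin_induction => //.
  - exact: measurable_trig_approximable.
  - move=> A B [mA tA] [mB tB]; split; first exact: measurableI.
    exact: trig_approximableI.
  - by move=> A [mA tA]; exact: approx_null.
  - move=> S mS S0.
    have : (\int[torus L]_(x in S `|` ~` S) (f x)%:E =
        \int[torus L]_(x in S) (f x)%:E + \int[torus L]_(x in ~` S) (f x)%:E)%E.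
      apply: integral_setU => //.
      + exact: measurableC.
      + by rewrite setUv; apply/measurable_EFinP; exact: sf.1.
      + by rewrite disj_set2E setICr.
    by rewrite setUv nullT S0 add0e => <-.
  - move=> F mF tF nF; rewrite integral_bigcup//.
      by rewrite eseries0.
    by apply: integrableS intf => //; exact: bigcupT_measurable.
have := @integral_ae_eq _ _ _ (torus L) setT measurableT (cst 0%E) (EFin \o f) intf.
move=> /(_ (measurable_cst _)) h.
have {h} : ae_eq (torus L) setT (EFin \o f) (cst 0%E).
  by apply: h => E _ mE; rewrite integral0; exact: null.
by apply: filterS => x /[apply] -[].
Qed.

End completeness.

(** * Fourier series *)

Section trigonometric_series.
Context {R : realType} {d : nat}.
Variables (L : 'rV[R]_d) (hL : forall i, 0 < L ord0 i).
Implicit Types (k l : 'rV[int]_d) (a b : 'rV[int]_d -> R) (s : seq 'rV[int]_d).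
Notation mu := (torus L).
Notation vol := (\prod_i L ord0 i).

Let muT : (mu setT < +oo)%E. Proof. exact: torus_lty. Qed.

Lemma vol_gt0 : 0 < vol. Proof. exact: prodr_gt0. Qed.

Lemma sqint_trig (x y : R) k : sqint mu (fun z => trig L x y k (vec z)).
Proof. apply: (sqint_continuous hL (phi := trig L x y k)); exact: continuous_trig. Qed.

Definition trigsum a b s (z : points R d) : R :=
  \sum_(k <- s) trig L (a k) (b k) k (vec z).

Lemma sqint_trigsum a b s : sqint mu (trigsum a b s).
Proof. by apply: sqint_sum => // k; exact: sqint_trig. Qed.

Lemma integral_mul_trigsum f a b s : sqint mu f ->
  \int[mu]_x (f x * trigsum a b s x) =
  \sum_(k <- s) \int[mu]_x (f x * trig L (a k) (b k) k (vec x)).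
Proof.
move=> sf; under eq_Rintegral do rewrite /trigsum mulr_sumr.
by apply: Rintegral_sum => // k; apply: sqint_mul => //; exact: sqint_trig.
Qed.

(** With c = x - iy, the function [trig L x y k] is the real part of c e_k and [trig L (- y) x k]
    its imaginary part. The identity is the real part of the product of c e_k with the conjugate of
    c' e_l. *)
Lemma trig_conj_mul (x y x' y' : R) k l z :
  trig L x y k z * trig L x' y' l z + trig L (- y) x k z * trig L (- y') x' l z =
  trig L (x * x' + y * y') (y * x' - x * y') (k - l) z.
Proof. by rewrite /trig thetaD thetaN cosB sinB; ring. Qed.

(* Adding the square of the conjugate sum turns the real sum into |sum c_k e_k|^2,
   which integrates to Parseval's sum. *)
Lemma trigsum_parseval a b s : uniq s ->
  \int[mu]_x (trigsum a b s x ^+ 2 + trigsum (fun k => - b k) a s x ^+ 2) =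
  vol * \sum_(k <- s) (a k ^+ 2 + b k ^+ 2).
Proof.
move=> us.
have -> : (fun x => trigsum a b s x ^+ 2 + trigsum (fun k => - b k) a s x ^+ 2) =
    (fun x => \sum_(k <- s) \sum_(l <- s)
      trig L (a k * a l + b k * b l) (b k * a l - a k * b l) (k - l) (vec x)).
  apply/funext => x; rewrite !expr2 /trigsum !mulr_suml -big_split/=.
  apply: eq_bigr => k _; rewrite !mulr_sumr -big_split/=.
  by apply: eq_bigr => l _; rewrite trig_conj_mul.
rewrite Rintegral_sum// => [|k]; last first.
  by apply: (sqint_integrable muT); apply: sqint_sum => // l; exact: sqint_trig.
rewrite mulr_sumr big_seq [RHS]big_seq; apply: eq_bigr => k ks.
rewrite Rintegral_sum// => [|l]; last first.
  by apply: (sqint_integrable muT); exact: sqint_trig.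
rewrite (bigD1_seq k)//= integral_trig// subrr eqxx [X in _ + X]big1 => [|l lk].
  by rewrite addr0 mulrC !expr2.
by rewrite integral_trig// subr_eq0 eq_sym (negbTE lk).
Qed.

Lemma integral_trigsum_sqr_le a b s : uniq s ->
  \int[mu]_x (trigsum a b s x ^+ 2) <= vol * \sum_(k <- s) (a k ^+ 2 + b k ^+ 2).
Proof.
move=> us; rewrite -trigsum_parseval//; apply: le_Rintegral => //.
- exact: (sqint_trigsum _ _ _).2.
- by apply: RintegrableD; exact: (sqint_trigsum _ _ _).2.
- by move=> x _; rewrite lerDl sqr_ge0.
Qed.

(** Without the customary factor 2, the complex Fourier coefficient is [cos_coef] - i [sin_coef],
    and [trigsum] over a set of frequencies stable under negation is a Fourier partial sum. *)
Definition cos_coef (f : points R d -> R) k : R :=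
  \int[mu]_x (f x * cos (theta L k (vec x))) / vol.

Definition sin_coef (f : points R d -> R) k : R :=
  \int[mu]_x (f x * sin (theta L k (vec x))) / vol.

Lemma integral_mul_trig f (x y : R) k : sqint mu f ->
  \int[mu]_z (f z * trig L x y k (vec z)) = vol * (x * cos_coef f k + y * sin_coef f k).
Proof.
move=> sf.
have cE z : cos (theta L k (vec z)) = trig L 1 0 k (vec z) by rewrite /trig; ring.
have sE z : sin (theta L k (vec z)) = trig L 0 1 k (vec z) by rewrite /trig; ring.
have ic : mu.-integrable setT (EFin \o (fun z => f z * cos (theta L k (vec z)))).
  by under eq_fun do rewrite cE; apply: sqint_mul => //; exact: sqint_trig.
have is_ : mu.-integrable setT (EFin \o (fun z => f z * sin (theta L k (vec z)))).
  by under eq_fun do rewrite sE; apply: sqint_mul => //; exact: sqint_trig.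
transitivity (\int[mu]_z (x * (f z * cos (theta L k (vec z))) +
    y * (f z * sin (theta L k (vec z))))).
  by apply: eq_Rintegral => z _; rewrite /trig; ring.
rewrite RintegralD//; [|exact: RintegrableZ|exact: RintegrableZ].
rewrite !RintegralZl// /cos_coef /sin_coef; field.
by rewrite gt_eqF// vol_gt0.
Qed.

Lemma cos_coefN f k : cos_coef f (- k) = cos_coef f k.
Proof. by rewrite /cos_coef; under eq_Rintegral do rewrite thetaN cosN. Qed.

Lemma sin_coefN f k : sqint mu f -> sin_coef f (- k) = - sin_coef f k.
Proof.
move=> sf; rewrite {1}/sin_coef.
under eq_Rintegral => z _.
  rewrite thetaN sinN (_ : - sin _ = trig L 0 (-1) k (vec z)).
  over.
  by rewrite /trig; ring.
rewrite integral_mul_trig// mul0r add0r mulN1r mulrAC divff ?mul1r//.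
by rewrite gt_eqF// vol_gt0.
Qed.

(** Expand the integral of (f - S)^2 >= 0, where S is the partial sum: the cross integral of f S
    equals [Q] and that of S^2 is at most [Q]. *)
Lemma bessel f s : sqint mu f -> uniq s ->
  vol * \sum_(k <- s) (cos_coef f k ^+ 2 + sin_coef f k ^+ 2) <= \int[mu]_x (f x ^+ 2).
Proof.
move=> sf us; set S := trigsum (cos_coef f) (sin_coef f) s.
have sS : sqint mu S by exact: sqint_trigsum.
set Q := vol * _.
have fS : \int[mu]_x (f x * S x) = Q.
  rewrite integral_mul_trigsum// /Q mulr_sumr; apply: eq_bigr => k _.
  by rewrite integral_mul_trig// !expr2.
have SS : \int[mu]_x (S x ^+ 2) <= Q by exact: integral_trigsum_sqr_le.
have : 0 <= \int[mu]_x ((f x ^+ 2 + S x ^+ 2) + (-2) * (f x * S x)).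
  by apply: Rintegral_ge0 => x _; have := sqr_ge0 (f x - S x); nra.
rewrite RintegralD//; last 2 first.
- by apply: RintegrableD; [exact: sf.2|exact: sS.2].
- by apply: RintegrableZ; exact: sqint_mul.
rewrite RintegralD//; [|exact: sf.2|exact: sS.2].
by rewrite RintegralZl//; [lra|exact: sqint_mul].
Qed.

(** The terms at [l] and at [- l] each contribute one half, which is why both must belong to [s] and
    why the parities of [a] and [b] enter. *)
Lemma trigsum_coef a b s (x y : R) l : uniq s -> l \in s -> - l \in s ->
  a (- l) = a l -> b (- l) = - b l ->
  \int[mu]_z (trigsum a b s z * trig L x y l (vec z)) = vol * (x * a l + y * b l).
Proof.
move=> us ls Nls aN bN.
under eq_Rintegral do rewrite mulrC.
rewrite integral_mul_trigsum; last exact: sqint_trig.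
have E k : \int[mu]_z (trig L x y l (vec z) * trig L (a k) (b k) k (vec z)) =
    (if k == - l then vol * ((x * a k - y * b k) / 2) else 0) +
    (if k == l then vol * ((x * a k + y * b k) / 2) else 0).
  transitivity (\int[mu]_z
     (trig L ((x * a k - y * b k) / 2) ((x * b k + y * a k) / 2) (l + k) (vec z) +
      trig L ((x * a k + y * b k) / 2) ((y * a k - x * b k) / 2) (l - k) (vec z))).
    apply: eq_Rintegral => z _.
    by rewrite /trig !thetaD !thetaN cosD sinD cosB sinB; field.
  rewrite RintegralD//; [|exact: sqint_integrable (sqint_trig _ _ _)..].
  rewrite !integral_trig//.
  have -> : (l + k == 0) = (k == - l) by rewrite addrC addr_eq0.
  have -> : (l - k == 0) = (k == l) by rewrite subr_eq0 eq_sym.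
  by do 2 case: ifP => _; rewrite ?[vol * _]mulrC ?addr0 ?add0r.
rewrite (eq_bigr _ (fun k _ => E k)).
have pick l' (F : 'rV[int]_d -> R) : l' \in s ->
    \sum_(k <- s) (if k == l' then F k else 0) = F l'.
  move=> l's; rewrite (bigD1_seq l')//= eqxx big1 ?addr0// => k kl.
  by rewrite (negbTE kl).
by rewrite big_split/= !pick// aN bN; field.
Qed.

(** The frequencies whose code in the countable encoding lies in [m, n); [pmap] skips the numbers
    that encode nothing. *)
Definition seg m n : seq 'rV[int]_d := pmap pickle_inv (iota m (n - m)).

Lemma seg_uniq m n : uniq (seg m n).
Proof. by apply: (pmap_uniq (g := pickle)) (iota_uniq _ _); exact: pickle_invK. Qed.

Lemma mem_seg0 k n : (pickle k < n)%N -> k \in seg 0 n.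
Proof.
by move=> kn; rewrite mem_pmap; apply/mapP; exists (pickle k);
  [rewrite mem_iota subn0|rewrite pickleK_inv].
Qed.

Lemma seg_cat m n : (m <= n)%N -> seg 0 n = seg 0 m ++ seg m n.
Proof. by move=> mn; rewrite /seg -pmap_cat !subn0 -iotaD subnKC. Qed.

Lemma trigsum_cat a b s1 s2 x :
  trigsum a b (s1 ++ s2) x = trigsum a b s1 x + trigsum a b s2 x.
Proof. exact: big_cat. Qed.

(** The partial sums along the encoding increase and are bounded, so they converge; [tau n] is taken
    so far out that the remaining tail is at most 4^-n. *)
Lemma exhausting_sequence (M : 'rV[int]_d -> R) (K : R) :
  (forall k, 0 <= M k) -> (forall s, uniq s -> \sum_(k <- s) M k <= K) ->
  exists tau : nat -> nat, [/\ forall n, (n <= tau n)%N,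
    forall n, (tau n <= tau n.+1)%N &
    forall n, \sum_(k <- seg (tau n) (tau n.+1)) M k <= 4^-1 ^+ n].
Proof.
move=> M0 MK; pose u n := \sum_(k <- seg 0 n) M k.
have u_nd m n : (m <= n)%N -> u m <= u n.
  by move=> mn; rewrite /u (seg_cat mn) big_cat lerDl sumr_ge0.
have u_cvg : cvgn u.
  apply: nondecreasing_is_cvgn; first by move=> m n; exact: u_nd.
  by exists K => _ [n _ <-]; exact/MK/seg_uniq.
have u_le n : u n <= limn u.
  by apply: nondecreasing_cvgn_le => // m m'; exact: u_nd.
have g n : {N | limn u - u N <= 4^-1 ^+ n}.
  apply: cid; have /cvgrPdist_le/(_ (4^-1 ^+ n)) := u_cvg.
  rewrite exprn_gt0// => /(_ isT)[N _ /(_ N (leqnn N))] h.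
  by exists N; apply: le_trans h; exact: ler_norm.
(* The maximum with the successor of the previous value makes [tau] strictly increasing, hence at
   least n. *)
pose fix tau n := match n with 0%N => sval (g 0%N) | n'.+1 => maxn (sval (g n)) (tau n').+1 end.
have tauS n : (tau n < tau n.+1)%N by exact: leq_maxr.
have tau_g n : (sval (g n) <= tau n)%N by case: n => [//|n]; exact: leq_maxl.
exists tau; split => [n|n|n]; last 2 first.
- exact/ltnW/tauS.
- apply: le_trans (svalP (g n)).
  have : u (tau n.+1) = u (tau n) + \sum_(k <- seg (tau n) (tau n.+1)) M k.
    by rewrite /u (seg_cat (ltnW (tauS n))) big_cat.
  have := u_le (tau n.+1); have := u_nd _ _ (tau_g n); lra.
- by elim: n => // n ih; exact: leq_ltn_trans ih (tauS n).
Qed.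

(* The truncations t depend only on the majorant M, so that several series can be
   summed along the same finite sets. *)
Lemma trigseries_limit (M : 'rV[int]_d -> R) (K : R) :
  (forall k, 0 <= M k) -> (forall s, uniq s -> \sum_(k <- s) M k <= K) ->
  exists t : nat -> seq 'rV[int]_d, [/\ forall n, uniq (t n),
    forall k, \forall n \near \oo, k \in t n &
    forall a b, (forall k, vol * (a k ^+ 2 + b k ^+ 2) <= M k) ->
      exists2 v, sqint mu v & forall psi, measurable_fun setT psi -> ae_bounded mu psi ->
        \int[mu]_x (trigsum a b (t n) x * psi x) @[n --> \oo] --> \int[mu]_x (v x * psi x)].
Proof.
move=> M0 MK; have [tau [ntau tauS tau4]] := exhausting_sequence M0 MK.
exists (fun n => seg 0 (tau n)); split.
- by move=> n; exact: seg_uniq.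
- move=> k; exists (pickle k).+1 => // n /= kn; apply: mem_seg0.
  exact: leq_trans kn (ntau n).
move=> a b abM.
have le_M s : uniq s -> \int[mu]_x (trigsum a b s x ^+ 2) <= \sum_(k <- s) M k.
  move=> us; apply: le_trans (integral_trigsum_sqr_le _ _ us) _.
  by rewrite mulr_sumr; apply: ler_sum.
have [|||v [sv _ cv]] := @sqint_limit _ _ _ mu muT (fun n => trigsum a b (seg 0 (tau n))) K.
- by move=> n; exact: sqint_trigsum.
- move=> n; apply: le_trans (tau4 n); apply: le_trans (le_M _ (seg_uniq _ _)).
  rewrite le_eqVlt; apply/orP; left; apply/eqP; apply: eq_Rintegral => x _.
  by rewrite (seg_cat (tauS n)) trigsum_cat addrAC subrr add0r.
- by move=> n; apply: le_trans (le_M _ (seg_uniq _ _)) _; exact/MK/seg_uniq.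
by exists v.
Qed.

(** Paired with a fixed mode, the truncated sums are eventually constant, namely once both [l] and
    [- l] belong to [t n]. *)
Lemma trigseries_limit_coef (t : nat -> seq 'rV[int]_d) a b v (x y : R) l :
  (forall n, uniq (t n)) -> (forall k, \forall n \near \oo, k \in t n) ->
  (forall k, a (- k) = a k) -> (forall k, b (- k) = - b k) ->
  (forall psi, measurable_fun setT psi -> ae_bounded mu psi ->
     \int[mu]_z (trigsum a b (t n) z * psi z) @[n --> \oo] --> \int[mu]_z (v z * psi z)) ->
  \int[mu]_z (v z * trig L x y l (vec z)) = vol * (x * a l + y * b l).
Proof.
move=> ut tk aN bN cv.
have ct := @continuous_trig _ _ L x y l.
have /(cvg_lim (@Rhausdorff R)) <- :=
  cv (trig L x y l \o vec) (measurable_continuous_vec ct) (bounded_continuous_vec _ ct).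
apply/(cvg_lim (@Rhausdorff R)); apply: cvg_near_cst.
by apply: filterS2 (tk l) (tk (- l)) => n ln Nln; exact: trigsum_coef.
Qed.

(** The parity conditions are those satisfied by the coefficients of every real square-integrable
    function. *)
Lemma riesz_fischer a b (K : R) :
  (forall k, a (- k) = a k) -> (forall k, b (- k) = - b k) ->
  (forall s, uniq s -> \sum_(k <- s) (a k ^+ 2 + b k ^+ 2) <= K) ->
  exists v, [/\ sqint mu v, cos_coef v =1 a & sin_coef v =1 b].
Proof.
move=> aN bN abK.
have [|s us|t [ut tk /(_ a b)]] := @trigseries_limit (fun k => vol * (a k ^+ 2 + b k ^+ 2)) (vol * K).
- by move=> k; rewrite mulr_ge0 ?addr_ge0 ?sqr_ge0// ltW// vol_gt0.
- by rewrite -mulr_sumr ler_pM2l ?vol_gt0// abK.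
move=> /(_ (fun k => lexx _))[v sv cv]; exists v.
have coef x y l := @trigseries_limit_coef t a b v x y l ut tk aN bN cv.
have V0 : vol != 0 by rewrite gt_eqF// vol_gt0.
split => // k.
- have := coef 1 0 k; rewrite integral_mul_trig// => /(mulfI V0); lra.
- have := coef 0 1 k; rewrite integral_mul_trig// => /(mulfI V0); lra.
Qed.

Lemma sqint_coef_inj f g : sqint mu f -> sqint mu g ->
  cos_coef f =1 cos_coef g -> sin_coef f =1 sin_coef g -> ae_eq mu setT f g.
Proof.
move=> sf sg cfg sfg.
have sfB : sqint mu (fun x => f x - g x) by exact: sqintB.
have : ae_eq mu setT (fun x => f x - g x) (cst 0).
  apply: trig_complete => // k x y.
  under eq_Rintegral do rewrite mulrBl.
  rewrite RintegralB//; [|apply: sqint_mul => //; exact: sqint_trig..].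
  by rewrite !integral_mul_trig// cfg sfg subrr.
by apply: filterS => x /[apply] /= /eqP; rewrite subr_eq0 => /eqP.
Qed.

(** Summing the majorants over [i], which Bessel's inequality keeps bounded, gives truncations
    common to the whole family. The limits have the coefficients of the [f i], hence equal them by
    completeness. *)
Lemma trigseries_approx m (f : 'I_m -> points R d -> R) :
  (forall i, sqint mu (f i)) ->
  exists t : nat -> seq 'rV[int]_d, forall i psi,
    measurable_fun setT psi -> ae_bounded mu psi ->
    \int[mu]_x (trigsum (cos_coef (f i)) (sin_coef (f i)) (t n) x * psi x) @[n --> \oo] -->
    \int[mu]_x (f i x * psi x).
Proof.
move=> sf.
pose M0 i k := vol * (cos_coef (f i) k ^+ 2 + sin_coef (f i) k ^+ 2).
have M0_ge0 i k : 0 <= M0 i k.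
  by rewrite mulr_ge0 ?addr_ge0 ?sqr_ge0// ltW// vol_gt0.
have [k|s us|t [ut tk ht]] := @trigseries_limit (fun k => \sum_i M0 i k)
  (\sum_i \int[mu]_x (f i x ^+ 2)).
- exact: sumr_ge0.
- rewrite exchange_big/=; apply: ler_sum => i _.
  by rewrite -mulr_sumr; exact: bessel.
exists t => i psi mpsi bpsi.
have [k|v sv cv] := ht (cos_coef (f i)) (sin_coef (f i)).
  by rewrite -/(M0 i k) (bigD1 i)//= lerDl sumr_ge0.
have coef x y l := @trigseries_limit_coef t _ _ v x y l ut tk
  (@cos_coefN (f i)) (fun k => sin_coefN k (sf i)) cv.
have V0 : vol != 0 by rewrite gt_eqF// vol_gt0.
have vf : ae_eq mu setT v (f i).
  apply: sqint_coef_inj => // k.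
  - have := coef 1 0 k; rewrite integral_mul_trig// => /(mulfI V0); lra.
  - have := coef 0 1 k; rewrite integral_mul_trig// => /(mulfI V0); lra.
rewrite (_ : \int[mu]_x (f i x * psi x) = \int[mu]_x (v x * psi x)); first exact: cv.
congr fine; apply: ae_eq_integral => //.
- by apply/measurable_EFinP; apply: measurable_funM; [exact: (sf i).1|].
- by apply/measurable_EFinP; apply: measurable_funM; [exact: sv.1|].
- by apply: filterS vf => x /[apply] ->.
Qed.

End trigonometric_series.

(** * The weak equations in terms of Fourier coefficients *)

Section weak_equations.
Context {R : realType} {d : nat}.
Variables (L F : 'rV[R]_d) (hL : forall i, 0 < L ord0 i).
Implicit Types (k l : 'rV[int]_d) (v w h : vfield R d) (phi : 'rV[R]_d -> R).
Notation mu := (torus L).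
Notation vol := (\prod_i L ord0 i).
Notation kappa := (wavenumber L).

Let muT : (mu setT < +oo)%E. Proof. exact: torus_lty. Qed.
Let V0 : vol != 0. Proof. by rewrite gt_eqF// vol_gt0. Qed.

Definition detuning k : R := 2 * pi * dot F (freq L k).

Lemma omegaE k : detuning k = \sum_j F ord0 j * kappa k j.
Proof. by rewrite /detuning /dot mulr_sumr; apply: eq_bigr => j _; rewrite mulrCA. Qed.

Lemma omegaN k : detuning (- k) = - detuning k.
Proof. by rewrite /detuning freqN dotC dotNl dotC mulrN. Qed.

Definition directional phi y : R := \sum_j F ord0 j * partial j phi y.

Lemma directional_trig (x y : R) k :
  directional (trig L x y k) = trig L (y * detuning k) (- (x * detuning k)) k.
Proof.
apply/funext => z; rewrite /directional omegaE /trig !mulr_sumr mulr_suml -sumrN mulr_suml -big_split/=.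
by apply: eq_bigr => j _; rewrite partial_trig /trig; ring.
Qed.

Lemma continuous_directional phi : test L phi -> continuous (directional phi).
Proof.
move=> tphi.
have := @continuous_big R 'I_d +%R 0 xpredT (@add_continuous R) _
  (index_enum 'I_d) (fun j (y : 'rV[R]_d) => F ord0 j * partial j phi y).
apply => j _ y; apply: (@cvgMr _ _ (nbhs y)).
exact: (test_continuous_partial (j := j) tphi).
Qed.

Lemma integral_trig_directional (x y : R) k phi : test L phi ->
  \int[mu]_z (trig L x y k (vec z) * directional phi (vec z)) =
  - \int[mu]_z (trig L (y * detuning k) (- (x * detuning k)) k (vec z) * phi (vec z)).
Proof.
move=> tphi; rewrite -directional_trig.
have sp j : sqint mu (partial j phi \o vec).
  exact: sqint_continuous (test_continuous_partial tphi).
have sphi : sqint mu (phi \o vec) by exact: sqint_continuous (test_continuous tphi).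
have spt j : sqint mu (partial j (trig L x y k) \o vec).
  by rewrite partial_trig; exact: sqint_trig.
transitivity (\int[mu]_z \sum_j F ord0 j * (partial j phi (vec z) * trig L x y k (vec z))).
  by apply: eq_Rintegral => z _; rewrite mulr_sumr; apply: eq_bigr => j _; ring.
transitivity (- \int[mu]_z \sum_j F ord0 j * (phi (vec z) * partial j (trig L x y k) (vec z))); last first.
  congr -%R; apply: eq_Rintegral => z _; rewrite mulr_suml; apply: eq_bigr => j _; ring.
rewrite !Rintegral_sum//; last 2 first.
- by move=> j; apply: RintegrableZ; exact: sqint_mul sphi (spt j).
- by move=> j; apply: RintegrableZ; exact: sqint_mul (sp j) (sqint_trig hL x y k).
rewrite -sumrN; apply: eq_bigr => j _.
rewrite !RintegralZl//; [|exact: sqint_mul sphi (spt j)|exact: sqint_mul (sp j) (sqint_trig hL x y k)].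
by rewrite integral_partial_trig// mulrN.
Qed.

Lemma transport_coef v h i k : sqint mu (v i) -> sqint mu (h i) ->
  transport_weak L F v h ->
  cos_coef L (h i) k = detuning k * sin_coef L (v i) k /\
  sin_coef L (h i) k = - (detuning k * cos_coef L (v i) k).
Proof.
move=> sv sh wvh.
have E x y : - (y * detuning k * cos_coef L (v i) k - x * detuning k * sin_coef L (v i) k) =
    x * cos_coef L (h i) k + y * sin_coef L (h i) k.
  apply: (mulfI V0); have := wvh i _ (test_trig hL x y k).
  rewrite integral_mul_trig// => <-; rewrite mulrN; congr -%R.
  under [RHS]eq_Rintegral => z _.
    rewrite -/(directional (trig L x y k) (vec z)) directional_trig.
    over.
  by rewrite integral_mul_trig//; ring.
by have := E 1 0; have := E 0 1; split; lra.
Qed.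

Lemma transport_of_coef v h : (forall i, sqint mu (v i)) -> (forall i, sqint mu (h i)) ->
  (forall i k, cos_coef L (h i) k = detuning k * sin_coef L (v i) k /\
     sin_coef L (h i) k = - (detuning k * cos_coef L (v i) k)) ->
  transport_weak L F v h.
Proof.
move=> sv sh vh i phi tphi.
(* Truncating [v i] and [h i] along the same finite sets lets the weak equation be checked mode by
   mode before the limit. *)
have [|t ht] := trigseries_approx hL (f := fun j : 'I_2 => if j == ord0 then v i else h i).
  by move=> j; case: ifP.
have cd := continuous_directional tphi; have cphi := test_continuous tphi.
have cv := ht ord0 _ (measurable_continuous_vec cd) (bounded_continuous_vec _ cd).
have ch := ht ord_max _ (measurable_continuous_vec cphi) (bounded_continuous_vec _ cphi).
have sd : sqint mu (directional phi \o vec) by exact: sqint_continuous.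
have sphi : sqint mu (phi \o vec) by exact: sqint_continuous.
have eqn n : \int[mu]_x (trigsum L (cos_coef L (h i)) (sin_coef L (h i)) (t n) x * phi (vec x)) =
    - \int[mu]_x (trigsum L (cos_coef L (v i)) (sin_coef L (v i)) (t n) x * directional phi (vec x)).
  under eq_Rintegral do rewrite mulrC.
  under [in RHS]eq_Rintegral do rewrite mulrC.
  rewrite (integral_mul_trigsum hL _ _ _ sphi) (integral_mul_trigsum hL _ _ _ sd).
  rewrite -sumrN; apply: eq_bigr => k _ /=.
  under [in RHS]eq_Rintegral do rewrite mulrC.
  rewrite integral_trig_directional// opprK.
  have [-> ->] := vh i k.
  by apply: eq_Rintegral => z _; rewrite /trig; ring.
apply: (cvg_unique (@Rhausdorff R) _ ch).
by rewrite /= (eq_cvg _ _ eqn); exact: cvgN cv.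
Qed.

Lemma div_free_coef v k : (forall i, sqint mu (v i)) -> div_free_weak L v ->
  \sum_i kappa k i * cos_coef L (v i) k = 0 /\
  \sum_i kappa k i * sin_coef L (v i) k = 0.
Proof.
move=> sv dv.
have E x y : \sum_i (y * kappa k i * cos_coef L (v i) k - x * kappa k i * sin_coef L (v i) k) = 0.
  have := dv _ (test_trig hL x y k); rewrite Rintegral_sum//; last first.
    by move=> i; rewrite partial_trig; apply: sqint_mul => //; exact: sqint_trig.
  move=> dv0; apply: (mulfI V0); rewrite mulr0 -[RHS]dv0 mulr_sumr.
  by apply: eq_bigr => i _; rewrite partial_trig integral_mul_trig//; ring.
split; [rewrite -[RHS](E 0 1)|rewrite -[RHS](E (-1) 0)]; apply: eq_bigr => i _; ring.
Qed.

Lemma div_free_of_coef v : (forall i, sqint mu (v i)) ->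
  (forall k, \sum_i kappa k i * cos_coef L (v i) k = 0 /\
     \sum_i kappa k i * sin_coef L (v i) k = 0) ->
  div_free_weak L v.
Proof.
move=> sv kv phi tphi.
have [t ht] := trigseries_approx hL sv.
have cp i := test_continuous_partial (j := i) tphi.
have sp i : sqint mu (partial i phi \o vec) by exact: sqint_continuous (cp i).
have sphi : sqint mu (phi \o vec) by exact: sqint_continuous (test_continuous tphi).
have ct i := ht i _ (measurable_continuous_vec (cp i)) (bounded_continuous_vec _ (cp i)).
rewrite Rintegral_sum//; last by move=> i; exact: sqint_mul (sv i) (sp i).
have : \sum_i \int[mu]_x (trigsum L (cos_coef L (v i)) (sin_coef L (v i)) (t n) x *
    partial i phi (vec x)) @[n --> \oo] --> \sum_i \int[mu]_x (v i x * partial i phi (vec x)).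
  apply: (@cvg_big R 'I_d +%R 0 xpredT (@add_continuous R)) => i _; exact: ct.
move=> cs; apply: (cvg_unique (@Rhausdorff R) cs).
apply: cvg_near_cst; apply: nearW => n.
transitivity (\sum_i \sum_(k <- t n) - \int[mu]_x (phi (vec x) *
    partial i (trig L (cos_coef L (v i) k) (sin_coef L (v i) k) k) (vec x))).
  apply: eq_bigr => i _; under eq_Rintegral do rewrite mulrC.
  rewrite (integral_mul_trigsum hL _ _ _ (sp i)); apply: eq_bigr => k _.
  by rewrite integral_partial_trig.
rewrite exchange_big/= big1// => k _.
rewrite sumrN -Rintegral_sum//; last first.
  by move=> i; rewrite partial_trig; apply: sqint_mul => //; exact: sqint_trig.
(* The integrand is [phi] times the divergence of a single mode, which vanishes pointwise by
   [kv]. *)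
rewrite (_ : (fun x => _) = cst 0) ?Rintegral_cst ?mul0r ?oppr0//.
apply/funext => x /=; rewrite -mulr_sumr.
have [kc ks] := kv k.
transitivity (phi (vec x) * ((\sum_i kappa k i * sin_coef L (v i) k) * cos (theta L k (vec x))
   - (\sum_i kappa k i * cos_coef L (v i) k) * sin (theta L k (vec x)))); last first.
  by rewrite kc ks !mul0r subr0 mulr0.
congr (_ * _); rewrite !mulr_suml -sumrB; apply: eq_bigr => i _.
by rewrite partial_trig /trig; ring.
Qed.

Lemma fourierE v k i : sqint mu (v i) ->
  fourier L v k ord0 i = (cos_coef L (v i) k +i* (- sin_coef L (v i) k))%C.
Proof.
move=> sv; rewrite mxE /cintegral.
have -> : \int[mu]_x complex.Re ((v i x)%:C%C * (expmode L k x)^*%C) =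
    vol * cos_coef L (v i) k.
  have := integral_mul_trig hL 1 0 k sv; rewrite mul1r mul0r addr0 => <-.
  by apply: eq_Rintegral => x _; rewrite /= /trig /theta; ring.
have -> : \int[mu]_x complex.Im ((v i x)%:C%C * (expmode L k x)^*%C) =
    vol * (- sin_coef L (v i) k).
  have := integral_mul_trig hL 0 (-1) k sv; rewrite mul0r add0r mulN1r => <-.
  by apply: eq_Rintegral => x _; rewrite /= /trig /theta; ring.
by apply/eqP; rewrite eq_complex /= !mul0r subr0 addr0 !mulKf ?eqxx.
Qed.

Lemma cos_coef0 f : cos_coef L f 0 = \int[mu]_x f x / vol.
Proof. by rewrite /cos_coef; under eq_Rintegral do rewrite theta0 cos0 mulr1. Qed.

Lemma sin_coef0 f : sin_coef L f 0 = 0.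
Proof.
rewrite /sin_coef; under eq_Rintegral do rewrite theta0 sin0 mulr0.
by rewrite Rintegral_cst// mul0r mul0r.
Qed.

Lemma L2per0P v : L2per0 L v <->
  forall i, sqint mu (v i) /\ cos_coef L (v i) 0 = 0.
Proof.
split=> v2 i; have [s0 i0] := v2 i.
  by rewrite cos_coef0 i0 mul0r; split => //; apply/sqint_Lfun.
split; first exact/sqint_Lfun.
by move: i0; rewrite cos_coef0 => /eqP; rewrite mulf_eq0 invr_eq0 (negbTE V0) orbF => /eqP.
Qed.

End weak_equations.

(** * Uniqueness, existence and resonant solutions *)

Section solvability.
Context {R : realType} {d : nat}.
Variables (L F : 'rV[R]_d) (hL : forall i, 0 < L ord0 i).
Implicit Types (k l : 'rV[int]_d) (v w h : vfield R d) (phi : 'rV[R]_d -> R).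
Notation mu := (torus L).
Notation vol := (\prod_i L ord0 i).
Notation kappa := (wavenumber L).
Notation omega := (detuning L F).

Let muT : (mu setT < +oo)%E. Proof. exact: torus_lty. Qed.
Let V0 : vol != 0. Proof. by rewrite gt_eqF// vol_gt0. Qed.

Lemma omega_eq0 k : (omega k == 0) = (dot F (freq L k) == 0).
Proof. by rewrite mulf_eq0 mulf_eq0 pnatr_eq0/= gt_eqF// pi_gt0. Qed.

Lemma resonant_set0P : resonant L F = set0 <-> forall k, k != 0 -> dot F (freq L k) != 0.
Proof.
split=> [r0 k k0|nr].
  by apply/negP => /eqP Fk; have : resonant L F k by []; rewrite r0.
by apply/seteqP; split => // k [k0 Fk]; have := nr _ k0; rewrite Fk eqxx.
Qed.

(** Away from zero the coefficients are determined by those of [h] upon division by [omega k]; at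
    zero they vanish because the mean does. *)
Lemma transport_unique v w h : (forall k, k != 0 -> dot F (freq L k) != 0) ->
  L2per0 L v -> L2per0 L w -> L2per0 L h ->
  transport_weak L F v h -> transport_weak L F w h -> ae_eq_field L v w.
Proof.
move=> nr /(L2per0P hL) v2 /(L2per0P hL) w2 /(L2per0P hL) h2 tv tw i.
have coef k := transport_coef hL k (v2 i).1 (h2 i).1 tv.
have coef' k := transport_coef hL k (w2 i).1 (h2 i).1 tw.
apply: sqint_coef_inj => //; [exact: (v2 i).1|exact: (w2 i).1|move=> k..].
- have [->|/nr k0] := eqVneq k 0; first by rewrite (v2 i).2 (w2 i).2.
  rewrite -omega_eq0 in k0; apply: (mulfI k0); apply: oppr_inj.
  by rewrite -(coef k).2 (coef' k).2.
- have [->|/nr k0] := eqVneq k 0; first by rewrite !sin_coef0.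
  rewrite -omega_eq0 in k0; apply: (mulfI k0).
  by rewrite -(coef k).1 (coef' k).1.
Qed.

(** At k = 0 the wave vector vanishes, and at resonant [k] the coefficients of [v] do. Elsewhere,
    [omega k] times the divergence coefficients of [v] are, up to sign, those of [h], hence zero. *)
Lemma div_free_transport h v : L2per0 L h -> div_free_weak L h ->
  L2per0 L v -> transport_weak L F v h ->
  (forall k, k \in resonant L F -> fourier L v k = 0) -> div_free_weak L v.
Proof.
move=> /(L2per0P hL) h2 dh /(L2per0P hL) v2 tv vR.
have sv i := (v2 i).1; have sh i := (h2 i).1.
apply: div_free_of_coef => // k.
have [->|k0] := eqVneq k 0.
  have k00 i : kappa 0 i = 0 by rewrite /wavenumber freq0 mxE mulr0.
  by split; apply: big1 => i _; rewrite k00 mul0r.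
have [Fk|Fk] := eqVneq (dot F (freq L k)) 0.
  have kR : k \in resonant L F by rewrite inE.
  have v0 i : cos_coef L (v i) k = 0 /\ sin_coef L (v i) k = 0.
    have := fourierE hL k (sv i); rewrite vR// mxE => /eqP.
    by rewrite eq_complex /= eq_sym [_ == - _]eq_sym oppr_eq0 => /andP[/eqP -> /eqP ->].
  by split; apply: big1 => i _; have [c0 s0] := v0 i; rewrite ?c0 ?s0 mulr0.
rewrite -omega_eq0 in Fk.
have [hc hs] := div_free_coef hL k sh dh.
split; apply: (mulfI Fk); rewrite mulr0 mulr_sumr.
- rewrite -[RHS]oppr0 -[in RHS]hs -sumrN; apply: eq_bigr => i _.
  by rewrite (transport_coef hL k (sv i) (sh i) tv).2; ring.
- rewrite -[RHS]hc; apply: eq_bigr => i _.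
  by rewrite (transport_coef hL k (sv i) (sh i) tv).1; ring.
Qed.

Lemma enorm_gt0 k : k != 0 -> 0 < enorm (to_real k : 'rV[R]_d).
Proof.
move=> k0; rewrite sqrtr_gt0 lt_def; apply/andP; split; last first.
  by apply: sumr_ge0 => i _; rewrite -expr2 sqr_ge0.
apply: contra k0 => /eqP k0; apply/eqP/rowP => i.
have : to_real k ord0 i * to_real k ord0 i = 0 :> R.
  by apply: (psumr_eq0P _ k0) => // j _; rewrite -expr2 sqr_ge0.
by move/eqP; rewrite mulf_eq0 orbb !mxE intr_eq0 => /eqP.
Qed.

Lemma normc_fourier_sqr h k i : sqint mu (h i) ->
  ComplexField.Normc.normc (fourier L h k ord0 i) ^+ 2 =
  cos_coef L (h i) k ^+ 2 + sin_coef L (h i) k ^+ 2.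
Proof.
move=> sh; rewrite fourierE//= sqr_sqrtr ?sqrrN//.
by rewrite addr_ge0// sqr_ge0.
Qed.

Lemma diophantine_nonresonant tau : diophantine L F tau ->
  forall k, k != 0 -> dot F (freq L k) != 0.
Proof.
move=> [C C0 hC] k k0; rewrite -normr_gt0; apply: lt_le_trans (hC _ k0).
by rewrite divr_gt0// powR_gt0// enorm_gt0.
Qed.

Lemma transport_solution tau h : 0 <= tau -> diophantine L F tau -> Hper0 L tau h ->
  exists2 v, L2per0 L v & transport_weak L F v h.
Proof.
move=> tau0 dio [/(L2per0P hL) h2 hs]; have nr := diophantine_nonresonant dio.
case: dio => C C0 hC; have sh i := (h2 i).1.
set g := (fun k => _) in hs.
(* These solve the coefficient relations for [v]. Since [omega 0] is zero and the inverse of zero is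
   zero, both vanish at k = 0. *)
pose a i k := - (sin_coef L (h i) k / omega k).
pose b i k := cos_coef L (h i) k / omega k.
(* The Diophantine bound reads D <= |k|^(2 tau) omega_k^2, so 1 / omega_k^2 <= |k|^(2 tau) / D <= (1
   + |k|^2)^tau / D, the weight in [Hper0]. *)
pose D := (2 * pi * C) ^+ 2.
have D0 : 0 < D by rewrite exprn_gt0// !mulr_gt0// pi_gt0.
pose G k : R := (1 + enorm (to_real k : 'rV[R]_d) ^+ 2) `^ tau *
  \sum_i (cos_coef L (h i) k ^+ 2 + sin_coef L (h i) k ^+ 2).
have gE : g = EFin \o G.
  apply/funext => k; rewrite /g /G/=; congr (_ * _)%:E.
  by apply: eq_bigr => i _; exact: normc_fourier_sqr.
have G0 k : 0 <= G k.
  by rewrite mulr_ge0 ?powR_ge0// sumr_ge0// => i _; rewrite addr_ge0 ?sqr_ge0//.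
have GK s : uniq s -> \sum_(k <- s) G k <= fine (\esum_(k in [set: 'rV[int]_d]) g k).
  move=> us; rewrite -lee_fin fineK; last first.
    by rewrite ge0_fin_numE// esum_ge0// => k _; rewrite gE lee_fin.
  rewrite -sumEFin; apply: esum_ge; exists [set` s]; first by split; [exact: finite_seq|].
  by rewrite fsbig_seq// gE.
have abG i k : a i k ^+ 2 + b i k ^+ 2 <= D^-1 * G k.
  have [->|k0] := eqVneq k 0.
    have o0 : omega 0 = 0.
      by rewrite /detuning freq0 /dot big1 ?mulr0// => j _; rewrite mxE mulr0.
    by rewrite /a /b o0 invr0 !mulr0 oppr0 expr0n addr0 mulr_ge0// invr_ge0 ltW.
  have o0 : omega k != 0 by rewrite omega_eq0 nr.
  set p := enorm (to_real k) `^ tau.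
  have p0 : 0 < p by rewrite powR_gt0 ?enorm_gt0.
  have Dp : D <= p ^+ 2 * omega k ^+ 2.
    rewrite -exprMn -[leRHS](real_normK (num_real _)).
    have Cp : 2 * pi * C <= `|p * omega k|.
      rewrite /detuning !normrM (gtr0_norm p0) (gtr0_norm (pi_gt0 R)) ger0_norm//.
      rewrite mulrCA ler_pM2l ?mulr_gt0 ?pi_gt0// mulrC -ler_pdivrMr//.
      exact: hC.
    rewrite ler_sqr ?nnegrE// !mulr_ge0// ?pi_ge0//; exact: ltW.
  have pG : p ^+ 2 <= (1 + enorm (to_real k : 'rV[R]_d) ^+ 2) `^ tau.
    have e0 := enorm_gt0 k0.
    rewrite /p expr2 -powRM ?(ltW e0)//; apply: ge0_ler_powR => //.
    - by rewrite nnegrE mulr_ge0// ltW.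
    - by rewrite nnegrE addr_ge0// sqr_ge0.
    - by rewrite -expr2 lerDr.
  have hi : 0 <= cos_coef L (h i) k ^+ 2 + sin_coef L (h i) k ^+ 2 by rewrite addr_ge0 ?sqr_ge0//.
  rewrite [leRHS]mulrC ler_pdivlMr//.
  apply: (@le_trans _ _ (p ^+ 2 * (cos_coef L (h i) k ^+ 2 + sin_coef L (h i) k ^+ 2))).
    have w0 : 0 < omega k ^+ 2 by rewrite lt_def sqr_ge0 sqrf_eq0 o0.
    have -> : a i k ^+ 2 + b i k ^+ 2 =
        (cos_coef L (h i) k ^+ 2 + sin_coef L (h i) k ^+ 2) / omega k ^+ 2.
      by rewrite /a /b; field.
    rewrite mulrAC ler_pdivrMr//.
    have := ler_wpM2l hi Dp; lra.
  apply: ler_pM => //; first exact: sqr_ge0.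
  by rewrite (bigD1 i)//= lerDl sumr_ge0// => j _; rewrite addr_ge0 ?sqr_ge0//.
have rf i : {v : points R d -> R | [/\ sqint mu v, cos_coef L v =1 a i & sin_coef L v =1 b i]}.
  apply: cid; apply: (@riesz_fischer _ _ L hL _ _ (D^-1 * fine (\esum_(k in [set: 'rV[int]_d]) g k))).
  (* Dividing by the odd function [omega] exchanges the parities: [a] is even and [b] is odd. *)
  - by move=> k; rewrite /a sin_coefN// omegaN invrN mulrNN.
  - by move=> k; rewrite /b cos_coefN omegaN invrN mulrN.
  - move=> s us; apply: (@le_trans _ _ (\sum_(k <- s) D^-1 * G k)); first exact: ler_sum.
    rewrite -mulr_sumr; apply: ler_wpM2l; last exact: GK.
    by rewrite invr_ge0 ltW.
exists (fun i => sval (rf i)).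
  apply/(L2per0P hL) => i; have [sv va _] := svalP (rf i); split => //.
  by rewrite va /a sin_coef0 mul0r oppr0.
apply: transport_of_coef => //.
  by move=> i; have [] := svalP (rf i).
move=> i k; have [_ -> ->] := svalP (rf i).
have [->|k0] := eqVneq k 0.
  by rewrite (h2 i).2 sin_coef0 /a /b (h2 i).2 sin_coef0 !mul0r oppr0 !mulr0 oppr0.
have o0 : omega k != 0 by rewrite omega_eq0 nr.
by rewrite /a /b; split; field.
Qed.

Lemma resonant_solution k : (1 < d)%N -> resonant L F k ->
  exists u, [/\ L2per0 L u, ~ ae_eq_field L u (fun=> cst 0),
    transport_weak L F u (fun=> cst 0) & div_free_weak L u].
Proof.
move=> d1 [k0 Fk].
have [i0 ki0] : exists i0, freq L k ord0 i0 != 0.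
  by have [j] := wavenumber_neq0 hL k0; rewrite mulf_eq0 negb_or => /andP[_ kj]; exists j.
have [i1 i10] : exists i1 : 'I_d, i1 != i0.
  have [z|z] := eqVneq (i0 : nat) 0%N.
    by exists (Ordinal d1); rewrite -val_eqE /= z.
  by exists (Ordinal (ltnW d1)); rewrite -val_eqE /= eq_sym.
(* A quarter turn of g(k) in the plane of the coordinates [i0] and [i1]: it is orthogonal to g(k),
   and its component at [i1] is nonzero. *)
pose c (i : 'I_d) : R := if i == i0 then - freq L k ord0 i1
   else if i == i1 then freq L k ord0 i0 else 0.
pose u : vfield R d := fun i x => trig L (c i) 0 k (vec x).
have su i : sqint mu (u i) by exact: sqint_trig.
exists u; split.
- move=> i; split; first exact/sqint_Lfun.
  by rewrite integral_trig// (negbTE k0).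
- move=> /(_ i1) ui1.
  have kk : k + k != 0.
    apply: contra k0 => /eqP /rowP kk; apply/eqP/rowP => i.
    have /eqP := kk i; rewrite !mxE -mulr2n mulrn_eq0 => /eqP; exact.
  have c1 : c i1 != 0 by rewrite /c (negbTE i10) eqxx.
  (* The mean square of the component at [i1] is c^2 / 2, because the mode at [k + k] averages to
     zero; so [u] does not vanish almost everywhere. *)
  have : \int[mu]_x (u i1 x * u i1 x) = vol * (c i1 ^+ 2 / 2).
    transitivity (\int[mu]_x (trig L (c i1 ^+ 2 / 2) 0 (k + k) (vec x) + trig L (c i1 ^+ 2 / 2) 0 0 (vec x))).
      apply: eq_Rintegral => x _.
      rewrite /u /trig !thetaD theta0 cos0 cosD !mul0r !addr0.
      have := cos2Dsin2 (theta L k (vec x)) => cs.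
      have {cs} -> : sin (theta L k (vec x)) * sin (theta L k (vec x)) =
        1 - cos (theta L k (vec x)) ^+ 2 by rewrite -cs; ring.
      by field.
    rewrite RintegralD//; [|apply: sqint_integrable (sqint_trig _ _ _ _) => //; exact: torus_lty..].
    by rewrite !integral_trig// (negbTE kk) eqxx add0r mulrC.
  have -> : \int[mu]_x (u i1 x * u i1 x) = \int[mu]_(x in setT) 0.
    congr fine; apply: ae_eq_integral => //.
    - by apply/measurable_EFinP; apply: measurable_funM; exact: (su i1).1.
    - by apply: filterS ui1 => x /[apply] /= ->; rewrite mulr0.
  rewrite (Rintegral_cst _ measurableT) mul0r => /esym/eqP; rewrite mulf_eq0 (negbTE V0)/=.
  by rewrite mulf_eq0 sqrf_eq0 (negbTE c1) invr_eq0 pnatr_eq0.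
- move=> i phi tphi.
  have ok : omega k = 0 by apply/eqP; rewrite omega_eq0 Fk.
  have := integral_trig_directional F hL (c i) 0 k tphi.
  rewrite ok !mulr0 oppr0 /directional => ->.
  rewrite opprK; apply: eq_Rintegral => x _.
  by rewrite /trig !mul0r addr0 !mul0r.
- move=> phi tphi.
  have sphi : sqint mu (phi \o vec) by exact: sqint_continuous (test_continuous tphi).
  have sp i : sqint mu (partial i phi \o vec).
    exact: sqint_continuous (test_continuous_partial tphi).
  rewrite Rintegral_sum//; last by move=> i; exact: sqint_mul (su i) (sp i).
  transitivity (\sum_i kappa k i * c i * \int[mu]_x (phi (vec x) * trig L 0 1 k (vec x))).
    apply: eq_bigr => i _; under eq_Rintegral do rewrite mulrC.
    rewrite integral_partial_trig// partial_trig -RintegralZl//; last first.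
      by apply: sqint_mul => //; exact: sqint_trig.
    rewrite -mulN1r -RintegralZl//; last by apply: sqint_mul => //; exact: sqint_trig.
    by apply: eq_Rintegral => x _; rewrite /trig; ring.
  rewrite -mulr_suml (bigD1 i0)//= (bigD1 i1)//= big1 => [|i /andP[ii0 ii1]].
    by rewrite /c eqxx (negbTE i10) eqxx /wavenumber; ring.
  by rewrite /c (negbTE ii0) (negbTE ii1) mulr0.
Qed.

End solvability.

(** Adding a nontrivial homogeneous solution to a given one is what refutes uniqueness in the
    presence of a resonance. *)
Lemma system_superposition (R : realType) (d : nat) (L F : 'rV[R]_d) (v u h : vfield R d) :
  (forall i, 0 < L ord0 i) -> L2per0 L v -> L2per0 L u -> system L F v h ->
  transport_weak L F u (fun=> cst 0) -> div_free_weak L u ->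
  L2per0 L (fun i x => v i x + u i x) /\ system L F (fun i x => v i x + u i x) h.
Proof.
move=> hL v2 u2 [tv dv] tu du.
have muT := torus_lty hL.
have sv i : sqint (torus L) (v i) by exact/sqint_Lfun/(v2 i).1.
have su i : sqint (torus L) (u i) by exact/sqint_Lfun/(u2 i).1.
split.
  move=> i; split; first by apply/sqint_Lfun; exact: sqintD.
  rewrite RintegralD//; [|exact: sqint_integrable..].
  by rewrite (v2 i).2 (u2 i).2 addr0.
split => [i phi tphi|phi tphi].
  have sd : sqint (torus L) (directional F phi \o vec).
    exact: (sqint_continuous hL (continuous_directional (F := F) tphi)).
  have tui := tu i phi tphi.
  rewrite -(tv i phi tphi).
  under eq_Rintegral do rewrite mulrDl.
  rewrite RintegralD//; [|exact: sqint_mul (sv i) sd|exact: sqint_mul (su i) sd].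
  rewrite opprD tui; under [X in _ + X]eq_Rintegral do rewrite /= mul0r.
  by rewrite Rintegral_cst// mul0r addr0.
have sp i : sqint (torus L) (partial i phi \o vec).
  exact: (sqint_continuous hL (test_continuous_partial tphi)).
under eq_Rintegral do (under eq_bigr do rewrite mulrDl; rewrite big_split/=).
rewrite RintegralD//; last 2 first.
- by apply: Rintegrable_sum => // i; exact: sqint_mul (sv i) (sp i).
- by apply: Rintegrable_sum => // i; exact: sqint_mul (su i) (sp i).
by rewrite dv// du// addr0.
Qed.

(** Taking the divergence of the transport equation shows that a solution of the full system forces
    [h] to be divergence-free. In the Diophantine part, existence for the system therefore assumes
    this of [h], while the transport equation alone is solved without it. *)
Theorem theorem2 (R : realType) (d : nat) (L F : 'rV[R]_d)
    (hd : d = 2%N \/ d = 3%N) (hL : forall i, 0 < L ord0 i) :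
  (forall h : vfield R d, L2per0 L h ->
     (exists2 v, L2per0 L v & system L F v h) ->
     ((forall v w, L2per0 L v -> L2per0 L w ->
         system L F v h -> system L F w h -> ae_eq_field L v w)
      <-> resonant L F = set0))
  /\
  (resonant L F = set0 <->
     forall k : 'rV[int]_d, k != 0 -> dot F (freq L k) != 0)
  /\
  (forall tau : R, d%:R - 1 <= tau -> diophantine L F tau ->
     forall h : vfield R d, Hper0 L tau h ->
       (exists v, [/\ L2per0 L v, transport_weak L F v h &
          forall w, L2per0 L w -> transport_weak L F w h -> ae_eq_field L v w])
       /\
       (div_free_weak L h ->
        exists v, [/\ L2per0 L v, system L F v h &
          forall w, L2per0 L w -> system L F w h -> ae_eq_field L v w]))
  /\
  (forall h v : vfield R d, L2per0 L h -> div_free_weak L h ->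
     L2per0 L v -> transport_weak L F v h ->
     (forall k, k \in resonant L F -> fourier L v k = 0) ->
     div_free_weak L v).
Proof.
have d1 : (1 < d)%N by case: hd => ->.
split; [move=> h h2 [v v2 sv]; split=> [uniq|/resonant_set0P nr v' w' v2' w2' sv' sw']|].
- apply/seteqP; split => // k /(resonant_solution hL d1)[u [u2 u0 tu du]].
  have [vu2 svu] := system_superposition hL v2 u2 sv tu du.
  apply: u0 => i; apply: filterS (uniq _ _ vu2 v2 svu sv i) => x /[apply] /= vu.
  by apply: (addrI (v i x)); rewrite vu addr0.
- exact: transport_unique v2' w2' h2 sv'.1 sw'.1.
split; first exact: resonant_set0P.
split=> [tau dtau dio h hs|h v h2 dh v2 tv vR]; last exact: div_free_transport tv vR.
have tau0 : 0 <= tau.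
  by apply: le_trans dtau; rewrite subr_ge0 ler1n ltnW.
have h2 := hs.1; have nr := diophantine_nonresonant dio.
have [v v2 tv] := transport_solution hL tau0 dio hs.
split; first by exists v; split => // w w2 tw; exact: transport_unique tv tw.
move=> dh; exists v; split => //; last by move=> w w2 [tw _]; exact: transport_unique tv tw.
(* Under the Diophantine condition there are no resonances, so the condition on resonant
   coefficients holds vacuously. *)
split=> //; apply: div_free_transport tv _ => // k.
by rewrite inE => -[k0 Fk]; have := nr _ k0; rewrite Fk eqxx.
Qed.
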